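(* Let $n\ge3$. If $(M^n,g,V)$ is asymptotically static of order $a\ge2$, then, for some constant $C>0$: (1) $(M^n,g)$ is asymptotically hyperbolic of order $2$; (2) $\|Ric(g)+ng-V^{-1}\nabla_g^2V\|_g\le Ce^{-2r}$; (3) $\|\nabla_g(V^{-1}\Delta_gV)\|_g\le Ce^{-ar}$ and $\|\nabla_g(Ric(g)-V^{-1}\nabla_g^2V)\|_g\le Ce^{-ar}$; where $r$ is the distance function to a fixed point in $M^n$ with respect to $g$.
   Context: Asymptotically hyperbolic (AH): a complete noncompact Riemannian manifold $(X,h)$ is AH of order $b$ if $\|Rm-\mathbf K\|_h\le Ce^{-b\rho}$, where $Rm$ is the Riemann curvature tensor of $h$, $\mathbf K_{ijkl}=-(h_{ik}h_{jl}-h_{il}h_{jk})$, $\rho$ is the distance function to a fixed point with respect to $h$, and $C$ is a positive constant independent of $\rho$. Essential set: a compact domain $E\subset M$ with smooth boundary that is strictly convex (second fundamental form with respect to the outward unit normal positive definite) and such that the outward normal exponential map $\partial E\times[0,\infty)\to\overline{M\setminus E}$ is a diffeomorphism. Asymptotically static of order $a\ge2$: $(M^n,g)$ is a smooth complete noncompact Riemannian manifold with an essential set, $V$ is a positive function on $M^n$, the manifold $(\mathbb S^1\times M^n,\ h=V^2d\theta^2+g)$ is AH of order $2$, and $\|\nabla_hRic(h)\|_h(\theta,x)\le Ce^{-a\rho(\theta,x)}$, where $\rho$ is the distance function to a fixed point in $\mathbb S^1\times M^n$ with respect to $h$ and $C>0$ is independent of $\rho$. *)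

(* Defs.v *)
From mathcomp Require Import all_boot all_order all_algebra.
From mathcomp Require Import all_classical all_reals all_analysis.

Set Implicit Arguments.
Unset Strict Implicit.
Unset Printing Implicit Defensive.

Import Order.TTheory GRing.Theory Num.Theory.
Import numFieldNormedType.Exports.

Local Open Scope classical_set_scope.
Local Open Scope ring_scope.

Definition partial (R : realType) (n : nat) (i : 'I_n) (f : 'rV[R]_n -> R)
  : 'rV[R]_n -> R := fun x => 'D_(delta_mx 0 i) f x.

(* Meaningful for open [U] only. *)
Fixpoint C_on (R : realType) (n k : nat) (U : set 'rV[R]_n)
    (f : 'rV[R]_n -> R) : Prop :=
  (forall x, U x -> {for x, continuous f}) /\
  if k is k'.+1 then
    forall i : 'I_n, (forall x, U x -> derivable f x (delta_mx 0 i)) /\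
                     C_on k' U (partial i f)
  else True.

Definition smooth_on (R : realType) (n : nat) (U : set 'rV[R]_n)
  (f : 'rV[R]_n -> R) : Prop := forall k, C_on k U f.

(* Charts are given by their inverses, the local parametrizations
   [par c : dom c -> M]; only the restriction of [par c] to [dom c] matters.
   [chart_at p] is a chosen chart around [p]. *)
Record atlas (R : realType) (n : nat) (M : topologicalType) := Atlas {
  chart : Type;
  dom : chart -> set 'rV[R]_n;
  par : chart -> 'rV[R]_n -> M;
  chart_at : M -> chart
}.

Definition range_chart (R : realType) (n : nat) (M : topologicalType)
  (A : atlas R n M) (c : chart A) : set M := par c @` dom c.

Definition coord (R : realType) (n : nat) (M : topologicalType)
    (A : atlas R n M) (c : chart A) (p : M) : 'rV[R]_n :=
  xget 0 [set x | dom c x /\ par c x = p].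

Definition smooth_atlas (R : realType) (n : nat) (M : topologicalType)
    (A : atlas R n M) : Prop :=
  [/\ forall p : M, range_chart (chart_at A p) p,
      forall c : chart A, open (dom c),
      forall (c : chart A) x y, dom c x -> dom c y -> par c x = par c y -> x = y,
      forall c : chart A, (forall x, dom c x -> {for x, continuous (par c)}) /\
        (forall U, open U -> U `<=` dom c -> open (par c @` U))
    & forall (c d : chart A) (j : 'I_n),
        smooth_on (dom c `&` par c @^-1` range_chart d)
                  (fun x => coord d (par c x) 0 j)].

Definition smooth_manifold (R : realType) (n : nat) (M : topologicalType)
    (A : atlas R n M) : Prop :=
  [/\ hausdorff_space M, @second_countable M, connected [set: M]
    & smooth_atlas A].

Definition smooth_fun (R : realType) (n : nat) (M : topologicalType)
    (A : atlas R n M) (W : set M) (f : M -> R) : Prop :=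
  forall c : chart A, smooth_on (dom c `&` par c @^-1` W) (f \o par c).

(* Meaningful for open [W] only. *)
Definition smooth_map (R : realType) (m n : nat) (M N : topologicalType)
    (A : atlas R m M) (B : atlas R n N) (W : set M) (F : M -> N) : Prop :=
  (forall p, W p -> {for p, continuous F}) /\
  forall (c : chart A) (d : chart B) (j : 'I_n),
    smooth_on (dom c `&` par c @^-1` (W `&` F @^-1` range_chart d))
              (fun x => coord d (F (par c x)) 0 j).

(* Smoothness on an arbitrary subset: existence of local smooth extensions. *)
Definition smooth_within (R : realType) (m n : nat) (M N : topologicalType)
    (A : atlas R m M) (B : atlas R n N) (S : set M) (F : M -> N) : Prop :=
  forall p, S p -> exists (W : set M) (F' : M -> N),
    [/\ open W, W p, smooth_map A B W F' &
        forall q, S q -> W q -> F' q = F q].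

(* [F] restricts to a diffeomorphism from the subset [S] onto the subset [T];
   for (products of) submanifolds with boundary this is the usual notion. *)
Definition diffeomorphism (R : realType) (m n : nat) (M N : topologicalType)
    (A : atlas R m M) (B : atlas R n N) (S : set M) (T : set N) (F : M -> N)
  : Prop :=
  exists G : N -> M,
    [/\ forall p, S p -> T (F p) /\ G (F p) = p,
        forall q, T q -> S (G q) /\ F (G q) = q,
        smooth_within A B S F & smooth_within B A T G].

Definition real_atlas (R : realType) : atlas R 1 R :=
  @Atlas R 1 R unit (fun=> setT) (fun _ x => x 0 0) (fun=> tt).

Definition prod_atlas (R : realType) (m n : nat) (M N : topologicalType)
    (A : atlas R m M) (B : atlas R n N) : atlas R (m + n) (M * N)%type :=
  @Atlas R (m + n) (M * N)%type (chart A * chart B)%type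
    (fun c => [set x | dom c.1 (lsubmx x) /\ dom c.2 (rsubmx x)])
    (fun c x => (par c.1 (lsubmx x), par c.2 (rsubmx x)))
    (fun p => (chart_at A p.1, chart_at B p.2)).

Definition circle (R : realType) : set (R * R) :=
  [set z | z.1 ^+ 2 + z.2 ^+ 2 = 1].
Arguments circle R : clear implicits.

Lemma circle_cos_sin (R : realType) (t : R) : circle R (cos t, sin t).
Proof. exact: cos2Dsin2. Qed.

Definition circle_point (R : realType) (t : R) : circle R :=
  SigSub (mem_set (circle_cos_sin t)).

(* The angle chart [t |-> (cos t, sin t)] on [t0 - pi < t < t0 + pi] is indexed
   by [t0]. *)
Definition circle_atlas (R : realType) : atlas R 1 (circle R) :=
  @Atlas R 1 (circle R) R
    (fun t0 => [set x : 'rV[R]_1 | t0 - pi < x 0 0 < t0 + pi])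
    (fun _ x => circle_point (x 0 0))
    (fun z => xget 0 [set t | circle_point t = z]).

(* [G x] is the matrix [(g_ij)] of the metric at the point with coordinates [x];
   tensor fields are given by their components in the chart. *)

Section LocalGeometry.
Context (R : realType) (n : nat) (G : 'rV[R]_n -> 'M[R]_n).
Implicit Types (x : 'rV[R]_n) (i j k l m : 'I_n) (f : 'rV[R]_n -> R).

Definition ginv i j x : R := invmx (G x) i j.

(* [christoffel k i j] is Gamma^k_ij. *)
Definition christoffel k i j x : R :=
  2^-1 * \sum_(l < n) ginv k l x *
    (partial i (fun y => G y j l) x + partial j (fun y => G y i l) x
     - partial l (fun y => G y i j) x).

(* R_ijkl = g(R(d_i, d_j) d_l, d_k) with
   R(X, Y) = nabla_X nabla_Y - nabla_Y nabla_X - nabla_[X, Y], so that R_ijij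
   is a sectional curvature up to a positive factor and [hyperbolic] below is
   the curvature tensor of a metric of constant curvature -1. *)
Definition riemann i j k l x : R :=
  \sum_(m < n) G x k m *
    (partial i (christoffel m j l) x - partial j (christoffel m i l) x
     + \sum_(p < n) (christoffel m i p x * christoffel p j l x
                     - christoffel m j p x * christoffel p i l x)).

Definition hyperbolic i j k l x : R :=
  - (G x i k * G x j l - G x i l * G x j k).

Definition ricci j l x : R :=
  \sum_(i < n) \sum_(k < n) ginv i k x * riemann i j k l x.

Definition hessian f i j x : R :=
  partial i (partial j f) x - \sum_(k < n) christoffel k i j x * partial k f x.

Definition laplacian f x : R :=
  \sum_(i < n) \sum_(j < n) ginv i j x * hessian f i j x.

(* [cov_vector Y i k] is (nabla_i Y)^k. *)
Definition cov_vector (Y : 'I_n -> 'rV[R]_n -> R) i k x : R :=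
  partial i (Y k) x + \sum_(j < n) christoffel k i j x * Y j x.

(* [cov_tensor2 T k i j] is (nabla_k T)_ij. *)
Definition cov_tensor2 (T : 'I_n -> 'I_n -> 'rV[R]_n -> R) k i j x : R :=
  partial k (T i j) x - \sum_(m < n) christoffel m k i x * T m j x
                      - \sum_(m < n) christoffel m k j x * T i m x.

Definition norm1 (T : 'I_n -> 'rV[R]_n -> R) x : R :=
  Num.sqrt (\sum_(i < n) \sum_(i' < n) ginv i i' x * T i x * T i' x).

Definition norm2 (T : 'I_n -> 'I_n -> 'rV[R]_n -> R) x : R :=
  Num.sqrt (\sum_(i < n) \sum_(i' < n) \sum_(j < n) \sum_(j' < n)
    ginv i i' x * ginv j j' x * T i j x * T i' j' x).

Definition norm3 (T : 'I_n -> 'I_n -> 'I_n -> 'rV[R]_n -> R) x : R :=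
  Num.sqrt (\sum_(i < n) \sum_(i' < n) \sum_(j < n) \sum_(j' < n)
            \sum_(k < n) \sum_(k' < n)
    ginv i i' x * ginv j j' x * ginv k k' x * T i j k x * T i' j' k' x).

Definition norm4 (T : 'I_n -> 'I_n -> 'I_n -> 'I_n -> 'rV[R]_n -> R) x : R :=
  Num.sqrt (\sum_(i < n) \sum_(i' < n) \sum_(j < n) \sum_(j' < n)
            \sum_(k < n) \sum_(k' < n) \sum_(l < n) \sum_(l' < n)
    ginv i i' x * ginv j j' x * ginv k k' x * ginv l l' x
    * T i j k l x * T i' j' k' l' x).

(* grad f / |grad f| *)
Definition unit_normal f k x : R :=
  (\sum_(l < n) ginv k l x * partial l f x) / norm1 (fun i => partial i f) x.

(* g(nabla_X nu, Y) for nu = grad f / |grad f| *)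
Definition second_form f x (X Y : 'rV[R]_n) : R :=
  \sum_(i < n) \sum_(k < n) \sum_(l < n)
    X 0 i * cov_vector (unit_normal f) i k x * G x k l * Y 0 l.

End LocalGeometry.

(* The matrices of the metric in all charts. *)
Definition metric (R : realType) (n : nat) (M : topologicalType)
  (A : atlas R n M) : Type := chart A -> 'rV[R]_n -> 'M[R]_n.

Section RiemannianGeometry.
Context (R : realType) (n : nat) (M : topologicalType) (A : atlas R n M).
Implicit Types (g : metric A) (c d : chart A) (p q : M) (gamma : R -> M)
  (E U : set M) (f : M -> R).

Definition riemannian_metric g : Prop :=
  [/\ forall c i j, smooth_on (dom c) (fun x => g c x i j),
      forall c x, dom c x -> (g c x)^T = g c x,
      forall c x, dom c x -> forall v : 'rV[R]_n, v != 0 ->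
        0 < (v *m g c x *m v^T) 0 0
    & forall c d x, dom c x -> range_chart d (par c x) ->
        let tau := fun y => coord d (par c y) in
        g c x = jacobian tau x *m g d (tau x) *m (jacobian tau x)^T].

Definition curve_coord c gamma (k : 'I_n) (t : R) : R := coord c (gamma t) 0 k.

Definition velocity c gamma (t : R) : 'rV[R]_n :=
  \row_k derive1 (curve_coord c gamma k) t.

Definition speed g gamma (t : R) : R :=
  let c := chart_at A (gamma t) in
  Num.sqrt ((velocity c gamma t *m g c (coord c (gamma t))
             *m (velocity c gamma t)^T) 0 0).

Definition curve_length g gamma : R :=
  \int[lebesgue_measure]_(t in `[0, 1]) speed g gamma t.

(* A curve parametrized by [0, 1], smooth up to the endpoints. *)
Definition smooth_path gamma : Prop :=
  exists W : set R, [/\ open W, `[0, 1] `<=` W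
                      & smooth_map (real_atlas R) A W gamma].

(* [s] is a piecewise smooth path from [p] to [q], as the list of its smooth
   pieces. *)
Fixpoint piecewise_path p (s : seq (R -> M)) q : Prop :=
  if s is gamma :: s' then
    [/\ smooth_path gamma, gamma 0 = p & piecewise_path (gamma 1) s' q]
  else p = q.

Definition rdist g p q : R :=
  inf [set L | exists2 s, piecewise_path p s q
                        & L = \sum_(gamma <- s) curve_length g gamma].

Definition complete_metric g : Prop :=
  forall u : nat -> M,
    (forall e : R, 0 < e -> exists N : nat, forall i j : nat,
       (N <= i)%N -> (N <= j)%N -> rdist g (u i) (u j) < e) ->
    exists p, u @ \oo --> p.

Definition complete_noncompact g : Prop :=
  [/\ smooth_manifold A, riemannian_metric g, complete_metric g
    & ~ compact [set: M]].

Definition geodesic g gamma : Prop :=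
  smooth_map (real_atlas R) A setT gamma /\
  forall t c, range_chart c (gamma t) -> forall k : 'I_n,
    derive1 (derive1 (curve_coord c gamma k)) t
    + \sum_(i < n) \sum_(j < n) christoffel (g c) k i j (coord c (gamma t))
        * derive1 (curve_coord c gamma i) t * derive1 (curve_coord c gamma j) t = 0.

Definition boundary E : set M := closure E `\` interior E.

(* [E] is the sublevel set [f <= 0] within [U], with [f] regular
   along [f = 0]; in particular grad f is outward normal along the boundary. *)
Definition defining_function E U f : Prop :=
  [/\ open U, smooth_fun A U f, forall q, U q -> (E q <-> f q <= 0)
    & forall c x, dom c x -> U (par c x) -> f (par c x) = 0 ->
        exists i, partial i (f \o par c) x != 0].

Definition smooth_boundary E : Prop :=
  forall p, boundary E p -> exists U f, U p /\ defining_function E U f.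

Definition strictly_convex g E : Prop :=
  forall U f, defining_function E U f ->
  forall c x, dom c x -> U (par c x) -> boundary E (par c x) ->
  forall X : 'rV[R]_n, X != 0 ->
    \sum_(i < n) X 0 i * partial i (f \o par c) x = 0 ->
    0 < second_form (g c) (f \o par c) x X X.

(* [F] is the outward normal exponential map on [boundary E * [0, +oo)]. *)
Definition normal_exponential g E (F : M * R -> M) : Prop :=
  forall p, boundary E p -> exists gamma : R -> M,
    [/\ geodesic g gamma, gamma 0 = p,
        forall U f, defining_function E U f -> U p ->
          forall c, range_chart c p -> forall k : 'I_n,
          velocity c gamma 0 0 k = unit_normal (g c) (f \o par c) k (coord c p)
      & forall t, 0 <= t -> F (p, t) = gamma t].

Definition essential_set g E : Prop :=
  [/\ compact E /\ connected (interior E), smooth_boundary E,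
      strictly_convex g E
    & exists2 F : M * R -> M, normal_exponential g E F
        & diffeomorphism (prod_atlas A (real_atlas R)) A
            (boundary E `*` `[0, +oo[) (closure (~` E)) F].

(* A pointwise bound on the norm of a tensor is stated in every chart, the norm
   being computed from the components in that chart. *)

Definition asymptotically_hyperbolic g (b : R) : Prop :=
  complete_noncompact g /\
  exists (o : M) (C : R), 0 < C /\ forall c x, dom c x ->
    norm4 (g c) (fun i j k l y =>
        riemann (g c) i j k l y - hyperbolic (g c) i j k l y) x
    <= C * expR (- (b * rdist g o (par c x))).

End RiemannianGeometry.

(* V^2 dtheta^2 + g on the product of the circle and M *)
Definition static_metric (R : realType) (n : nat) (M : topologicalType)
    (A : atlas R n M) (g : metric A) (V : M -> R)
  : metric (prod_atlas (circle_atlas R) A) :=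
  fun c y => block_mx (V (par c.2 (rsubmx y)) ^+ 2)%:M 0
                      0 (g c.2 (rsubmx y)).

Definition asymptotically_static (R : realType) (n : nat) (M : topologicalType)
    (A : atlas R n M) (g : metric A) (V : M -> R) (a : R) : Prop :=
  let h := static_metric g V in
  [/\ complete_noncompact g /\ exists E, essential_set g E,
      smooth_fun A setT V /\ forall p, 0 < V p,
      asymptotically_hyperbolic h 2
    & exists (o : circle R * M) (C : R), 0 < C /\
        forall (c : chart (prod_atlas (circle_atlas R) A)) y, dom c y ->
          norm3 (h c) (cov_tensor2 (h c) (ricci (h c))) y
          <= C * expR (- (a * rdist h o (par c y)))].

(* Main.v *)
Require Import Defs.
From mathcomp Require Import all_boot all_order all_algebra.
From mathcomp Require Import all_classical all_reals all_analysis.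
From mathcomp Require Import ring lra.
Set Implicit Arguments.
Unset Strict Implicit.
Unset Printing Implicit Defensive.

Import Order.TTheory GRing.Theory Num.Theory.
Import numFieldNormedType.Exports.

Local Open Scope classical_set_scope.
Local Open Scope ring_scope.

(** The metric h = V^2 dt^2 + g on the product of the circle with M is a warped
    product, and each tensor to be estimated on M is a part of a tensor of h for
    which decay is assumed.

    In coordinates adapted to the product, with o the circle direction and
    i, j, k, l base directions, one finds, writing f = (laplacian V) / V,

      Riem(h)_ijkl = Riem(g)_ijkl,      Riem(h)_ojol = - V (hess V)_jl,
      Ric(h)_jl = (Ric(g) - (hess V) / V)_jl,      Ric(h)_oo = - V^2 f,
      (nabla Ric(h))_kij = (nabla (Ric(g) - (hess V) / V))_kij,
      (nabla Ric(h))_koo = - V^2 d_k f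

    ([riemann_warped], [riemann_warped_circle], [ricci_warped],
    [ricci_warped_circle], [cov_ricci_warped], [cov_ricci_warped_circle]).
    An orthonormal frame for g and the unit vector in the circle direction form
    an orthonormal frame for h, and there the norm is the Euclidean norm of the
    components.  Hence the difference of the curvature of g from the hyperbolic
    model, the covariant derivative of Ric(g) - (hess V) / V, and df have norms
    at most those of the corresponding tensors of h ([norm4_warped_le],
    [norm3_warped_le], [norm1_warped_le]).  The tensor Ric(g) + n g - (hess V) / V
    is the base part of the trace of the curvature difference of h, so its norm
    is at most sqrt (n + 1) times the norm of that difference
    ([norm2_warped_le]).

    It remains to replace the distance of h by that of g.  A path in the product
    projects to a path in M that is no longer, so the distance of g between the
    projections is at most the distance of h ([rdist_snd_le]), and an exponential
    that decays in the latter also decays in the former.  The triangle inequality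
    moves the base point at the cost of a constant ([expR_decay_le]).

    The comparison of lengths needs analysis of its own: lengths are integrals of
    a speed that is computed in charts varying with the point, so the
    integrability of the speed rests on its independence of the chart, hence on
    the chain rule and on the differentiability of functions with continuous
    partial derivatives ([C1_differentiable]); and distances are infima over
    nonempty sets because a connected manifold is connected by piecewise smooth
    paths ([piecewise_path_exists]). *)

(** * Smooth functions on open subsets of a coordinate space *)

Section SmoothFunctions.
Context (R : realType) (n : nat).
Implicit Types (U : set 'rV[R]_n) (f g : 'rV[R]_n -> R) (i : 'I_n).

Lemma near_on U f g x : open U -> U x -> (forall y, U y -> f y = g y) ->
  \forall y \near x, f y = g y.
Proof.
by move=> oU Ux fg; apply: filterS (open_nbhs_nbhs (conj oU Ux)) => y /fg.
Qed.

Lemma partial_on U f g x i : open U -> U x -> (forall y, U y -> f y = g y) ->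
  partial i f x = partial i g x.
Proof. by move=> oU Ux fg; apply/near_eq_derive/(near_on oU Ux fg). Qed.

Lemma near_eq_continuous (S T : topologicalType) (f g : S -> T) x :
  (\forall y \near x, f y = g y) -> {for x, continuous f} ->
  {for x, continuous g}.
Proof.
move=> fg; have e := nbhs_singleton fg.
have h : g @ x `=>` f @ x by apply: near_eq_cvg.
by move=> cf; move: (cvg_trans h cf); rewrite e.
Qed.

(** The recursive clause of [C_on] applies [partial], whose value at a point
    sees only a neighbourhood of it; so the class is local, and the function
    may be replaced near each point by one that is equal to it there. *)
Lemma C_on_local k U f :
  (forall x, U x -> exists U' f', [/\ open U', U' x, C_on k U' f' &
     forall y, U' y -> f' y = f y]) -> C_on k U f.
Proof.
elim: k U f => [|k IH] U f H /=.
  split=> // x /H[U' [f' [oU' Ux [cf _] ff']]].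
  exact: near_eq_continuous (near_on oU' Ux ff') (cf _ Ux).
split=> [x /H[U' [f' [oU' Ux [cf _] ff']]]|i].
  exact: near_eq_continuous (near_on oU' Ux ff') (cf _ Ux).
split=> [x /H[U' [f' [oU' Ux [cf df] ff']]]|].
  have near_ff' := near_on oU' Ux ff'.
  exact: near_eq_derivable near_ff' ((df i).1 _ Ux).
apply: IH => x /H[U' [f' [oU' Ux [cf df] ff']]].
exists U', (partial i f'); split => //; first exact: (df i).2.
by move=> y Uy; apply: partial_on oU' Uy ff'.
Qed.

Lemma C_on_eq k U f g : open U -> (forall x, U x -> f x = g x) ->
  C_on k U f -> C_on k U g.
Proof. by move=> oU fg Cf; apply: C_on_local => x Ux; exists U, f. Qed.

Lemma C_on_sub k U U' f : U `<=` U' -> C_on k U' f -> C_on k U f.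
Proof.
move=> UU'; elim: k f => [|k IH] f /= [cf df].
  by split=> // x /UU'/cf.
split=> [x /UU'/cf//|i].
by split=> [x /UU'/((df i).1)//|]; apply: IH => //; case: (df i).
Qed.

Lemma C_onW k U f : C_on k.+1 U f -> C_on k U f.
Proof.
elim: k f => [|k IH] f [cf df]; first by split.
by split=> // i; split; [case: (df i)|apply: IH; case: (df i)].
Qed.

Lemma C_on_cst k U (a : R) : C_on k U (fun=> a).
Proof.
elim: k a => [|k IH] a /=; first by split=> // x _; exact: cst_continuous.
split=> [x _|i]; first exact: cst_continuous.
split=> [x _|]; first exact: derivable_cst.
have -> : partial i (fun=> a) = fun=> 0 by apply/funext => x; apply: derive_cst.
exact: IH.
Qed.

Lemma C_on_add k U f g : open U -> C_on k U f -> C_on k U g ->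
  C_on k U (fun x => f x + g x).
Proof.
move=> oU; elim: k f g => [|k IH] f g /= [cf df] [cg dg].
  by split=> // x Ux; apply: continuousD; [apply: cf|apply: cg].
split=> [x Ux|i]; first by apply: continuousD; [apply: cf|apply: cg].
split=> [x Ux|]; first by apply: derivableD; [apply: (df i).1|apply: (dg i).1].
have := IH _ _ (df i).2 (dg i).2; apply: C_on_eq => // x Ux.
by rewrite /partial -deriveD//; [apply: (df i).1|apply: (dg i).1].
Qed.

Lemma partialM f g x i : derivable f x (delta_mx 0 i) ->
  derivable g x (delta_mx 0 i) ->
  partial i (fun x => f x * g x) x = f x * partial i g x + g x * partial i f x.
Proof. exact: deriveM. Qed.

Lemma partialN f x i : derivable f x (delta_mx 0 i) ->
  partial i (fun x => - f x) x = - partial i f x.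
Proof. exact: deriveN. Qed.

Lemma partialV f x i : f x != 0 -> derivable f x (delta_mx 0 i) ->
  partial i (fun x => (f x)^-1) x = - (f x) ^- 2 * partial i f x.
Proof. exact: deriveV. Qed.

(** The derivative of a product mixes the factors with their derivatives, so
    the induction needs the factors one degree lower as well ([C_onW]). *)
Lemma C_on_mul k U f g : open U -> C_on k U f -> C_on k U g ->
  C_on k U (fun x => f x * g x).
Proof.
move=> oU; elim: k f g => [|k IH] f g Cf Cg.
  have [[cf df] [cg dg]] := (Cf, Cg).
  by split=> // x Ux; apply: continuousM; [apply: cf|apply: cg].
have [[cf df] [cg dg]] := (Cf, Cg).
split=> [x Ux|i]; first by apply: continuousM; [apply: cf|apply: cg].
split=> [x Ux|]; first by apply: derivableM; [apply: (df i).1|apply: (dg i).1].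
have := C_on_add oU (IH _ _ (C_onW Cf) (dg i).2) (IH _ _ (C_onW Cg) (df i).2).
apply: C_on_eq => // x Ux.
by rewrite partialM//; [apply: (df i).1|apply: (dg i).1].
Qed.

Lemma C_on_inv k U f : open U -> (forall x, U x -> f x != 0) -> C_on k U f ->
  C_on k U (fun x => (f x)^-1).
Proof.
move=> oU f0; elim: k => [|k IH] Cf.
  have [cf df] := Cf.
  by split=> // x Ux; apply: continuousV; [apply: f0|apply: cf].
have [cf df] := Cf.
split=> [x Ux|i]; first by apply: continuousV; [apply: f0|apply: cf].
split=> [x Ux|]; first by apply: derivableV; [apply: f0|apply: (df i).1].
have CV := IH (C_onW Cf).
have := C_on_mul oU (C_on_mul oU (C_on_cst k U (-1)) (C_on_mul oU CV CV)) (df i).2.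
apply: C_on_eq => // x Ux.
rewrite partialV//; [|exact: f0|exact: (df i).1].
by rewrite mulN1r -expr2 exprVn.
Qed.

Lemma smooth_on_eq U f g : open U -> (forall x, U x -> f x = g x) ->
  smooth_on U f -> smooth_on U g.
Proof. by move=> oU fg Cf k; apply: (C_on_eq oU fg). Qed.

Lemma smooth_on_sub U U' f : U `<=` U' -> smooth_on U' f -> smooth_on U f.
Proof. by move=> UU' sf k; apply: C_on_sub (sf k). Qed.

Lemma smooth_on_cst U (a : R) : smooth_on U (fun=> a).
Proof. by move=> k; apply: C_on_cst. Qed.

Lemma smooth_on_add U f g : open U -> smooth_on U f -> smooth_on U g ->
  smooth_on U (fun x => f x + g x).
Proof. by move=> oU sf sg k; apply: C_on_add. Qed.

Lemma smooth_on_mul U f g : open U -> smooth_on U f -> smooth_on U g ->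
  smooth_on U (fun x => f x * g x).
Proof. by move=> oU sf sg k; apply: C_on_mul. Qed.

Lemma smooth_on_opp U f : open U -> smooth_on U f ->
  smooth_on U (fun x => - f x).
Proof.
move=> oU sf; have := smooth_on_mul oU (smooth_on_cst U (-1)) sf.
by apply: smooth_on_eq => // x; rewrite mulN1r.
Qed.

Lemma smooth_on_inv U f : open U -> (forall x, U x -> f x != 0) ->
  smooth_on U f -> smooth_on U (fun x => (f x)^-1).
Proof. by move=> oU f0 sf k; apply: C_on_inv. Qed.

Lemma smooth_on_sum U (I : Type) (s : seq I) (P : pred I)
    (F : I -> 'rV[R]_n -> R) :
  open U -> (forall j, smooth_on U (F j)) ->
  smooth_on U (fun x => \sum_(j <- s | P j) F j x).
Proof.
move=> oU sF; elim: s => [|j s IH].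
  by apply: smooth_on_eq (smooth_on_cst U 0) => // x; rewrite big_nil.
case Pj : (P j).
  by apply: smooth_on_eq (smooth_on_add oU (sF j) IH) => // x; rewrite big_cons Pj.
by apply: smooth_on_eq IH => // x; rewrite big_cons Pj.
Qed.

Lemma smooth_on_prod U (I : Type) (s : seq I) (P : pred I)
    (F : I -> 'rV[R]_n -> R) :
  open U -> (forall j, smooth_on U (F j)) ->
  smooth_on U (fun x => \prod_(j <- s | P j) F j x).
Proof.
move=> oU sF; elim: s => [|j s IH].
  by apply: smooth_on_eq (smooth_on_cst U 1) => // x; rewrite big_nil.
case Pj : (P j).
  by apply: smooth_on_eq (smooth_on_mul oU (sF j) IH) => // x; rewrite big_cons Pj.
by apply: smooth_on_eq IH => // x; rewrite big_cons Pj.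
Qed.

Lemma smooth_on_partial U f i : smooth_on U f -> smooth_on U (partial i f).
Proof. by move=> sf k; case: (sf k.+1) => _ /(_ i)[]. Qed.

Lemma smooth_on_derivable U f x i : smooth_on U f -> U x ->
  derivable f x (delta_mx 0 i).
Proof. by move=> sf; case: (sf 1%N) => _ /(_ i)[] + _; apply. Qed.

Lemma smooth_on_continuous U f x : smooth_on U f -> U x ->
  {for x, continuous f}.
Proof. by move=> sf; case: (sf 0%N) => + _; apply. Qed.

Lemma smooth_on_det m U (G : 'rV[R]_n -> 'M[R]_m) : open U ->
  (forall i j : 'I_m, smooth_on U (fun x => G x i j)) ->
  smooth_on U (fun x => \det (G x)).
Proof.
move=> oU sG; apply: smooth_on_sum => // s; apply: smooth_on_mul => //.
  exact: smooth_on_cst.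
exact: smooth_on_prod.
Qed.

(** Cramer's rule: the entries of the inverse are cofactors, which are
    polynomials in the entries, divided by the determinant. *)
Lemma smooth_on_invmx m U (G : 'rV[R]_n -> 'M[R]_m) (i j : 'I_m) : open U ->
  (forall i j : 'I_m, smooth_on U (fun x => G x i j)) ->
  (forall x, U x -> G x \in unitmx) ->
  smooth_on U (fun x => invmx (G x) i j).
Proof.
move=> oU sG uG.
apply: (@smooth_on_eq U (fun x => (\det (G x))^-1 * \adj (G x) i j)) => //.
  by move=> x Ux; rewrite /invmx uG// !mxE.
apply: smooth_on_mul => //; first apply: smooth_on_inv => //.
- by move=> x /uG; rewrite unitmxE unitfE.
- exact: smooth_on_det.
apply: (@smooth_on_eq U (fun x => (-1) ^+ (j + i) * \det (row' j (col' i (G x))))) => //.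
  by move=> x Ux; rewrite !mxE /cofactor.
apply: smooth_on_mul => //; first exact: smooth_on_cst.
apply: smooth_on_det => // i' j'.
by apply: (@smooth_on_eq U (fun x => G x (lift j i') (lift i j'))) => // x Ux; rewrite !mxE.
Qed.

End SmoothFunctions.

(** * Continuous partial derivatives give differentiability *)

Section Differentiability.
Context (R : realType) (n : nat).
Implicit Types (U : set 'rV[R]_n) (f g : 'rV[R]_n -> R) (i : 'I_n).

(** An increment that is small with respect to the displacement means a zero
    differential.  Stated alone because it reduces differentiability to a
    single estimate once the candidate linear part is subtracted. *)
Lemma differentiable_flat (V W : normedModType R) (f : V -> W) x :
  (forall e, 0 < e -> \forall y \near x, `|f y - f x| <= e * `|y - x|) ->
  differentiable f x.
Proof.
move=> H.
have Hf : f \o shift x = cst (f x) + (\0 : V -> W) +o_ 0 id.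
  apply/eqaddoP => _/posnumP[e] /=.
  have := H e%:num [gt0 of e%:num]; rewrite (near_shift 0).
  apply: filterS => y /=.
  by rewrite !fctE /= subr0 addrK addr0.
have c0 : continuous (\0 : V -> W) by move=> ?; exact: cst_continuous.
apply/diff_locallyP; rewrite (diff_unique c0 Hf); split => //.
Qed.

Lemma is_derive_line f (x v : 'rV[R]_n) (t : R) : derivable f (t *: v + x) v ->
  is_derive t 1 (fun s => f (s *: v + x)) ('D_v f (t *: v + x)).
Proof.
have E : (fun h : R => h^-1 *: (((fun s => f (s *: v + x)) \o shift t) (h *: 1)
      - f (t *: v + x))) =
    (fun h => h^-1 *: ((f \o shift (t *: v + x)) (h *: v) - f (t *: v + x))).
  apply/funext => h /=; congr (_ *: (f _ - _)).
  by rewrite scaler1 scalerDl addrA.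
move=> df; split; first by rewrite /derivable E.
by rewrite /derive E.
Qed.

Lemma mean_value_line f (x v : 'rV[R]_n) (h : R) :
  (forall t : R, `|t| <= `|h| -> derivable f (t *: v + x) v) ->
  exists2 t, `|t| <= `|h| & f (h *: v + x) - f x = 'D_v f (t *: v + x) * h.
Proof.
move=> df.
pose p (s : R) := f (s *: v + x).
have dp (t : R) : `|t| <= `|h| -> is_derive t 1 p ('D_v f (t *: v + x)).
  by move=> /df; exact: is_derive_line.
have cp (t : R) : `|t| <= `|h| -> {for t, continuous p}.
  by move=> /dp[dpt _]; apply/differentiable_continuous/derivable1_diffP.
have p0 : p 0 = f x by rewrite /p scale0r add0r.
have [h0|h0] := leP 0 h.
  have le (t : R) : t \in `[0, h] -> `|t| <= `|h|.
    by rewrite in_itv => /andP[t0 th]; rewrite !ger0_norm.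
  have [| |t /le th /=] := @MVT_segment R p (fun t => 'D_v f (t *: v + x)) _ _ h0.
  - by move=> t /subset_itv_oo_cc/le/dp.
  - apply: continuous_in_subspaceT => t; rewrite inE => /le/cp //.
  by rewrite p0 subr0 => E; exists t.
have le (t : R) : t \in `[h, 0] -> `|t| <= `|h|.
  by rewrite in_itv => /andP[th t0]; rewrite !ler0_norm ?lerN2// ltW.
have [| |t /le th /=] := @MVT_segment R p (fun t => 'D_v f (t *: v + x)) _ _ (ltW h0).
- by move=> t /subset_itv_oo_cc/le/dp.
- apply: continuous_in_subspaceT => t; rewrite inE => /le/cp //.
rewrite p0 sub0r mulrN => /eqP; rewrite -opprB eqr_opp => /eqP E.
by exists t.
Qed.

Lemma coord_le_norm m (A : 'M[R]_(m, n)) (i : 'I_m) (j : 'I_n) : `|A i j| <= `|A|.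
Proof.
by rewrite [leRHS]/Num.Def.normr/= mx_normrE; exact: (le_bigmax _ _ (i, j)).
Qed.

(** The increment is telescoped along the edges of a box, changing one
    coordinate at a time; on each edge the mean value theorem replaces the
    increment by a partial derivative at a nearby point.  The chain rule for
    changes of charts below rests on this. *)
Lemma C1_differentiable U f x : open U -> C_on 1 U f -> U x ->
  differentiable f x.
Proof.
move=> oU [_ C1f] Ux.
(* the candidate differential *)
pose L (y : 'rV[R]_n) : R := \sum_(i < n) partial i f x * y 0 i.
have dL : differentiable L x.
  rewrite (_ : L = \sum_(i < n) (fun y : 'rV[R]_n => partial i f x * y 0 i)); last first.
    by apply/funext => y; rewrite fct_sumE.
  apply: differentiable_sum => i.
  by apply: differentiableM; [exact: differentiable_cst|exact: differentiable_coord].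
suff : differentiable (fun y => f y - L y) x.
  move=> dr; have := differentiableD dr dL; rewrite (_ : _ + L = f)//.
  by apply/funext => y; rewrite fctE /= subrK.
apply: differentiable_flat => e e0.
(* [e] is shared among the [n] edges of the box; [n.+1] since [n] may be 0 *)
pose e' := e / n.+1%:R.
have e'0 : 0 < e' by rewrite divr_gt0.
have : \forall y \near x, U y /\ forall i, `|partial i f y - partial i f x| <= e'.
  near=> y; split; first by near: y; exact: open_nbhs_nbhs.
  near: y; apply: filter_forall => i.
  have [cf _] : C_on 0 U (partial i f) by case: (C1f i).
  have /cvgrPdist_le /(_ _ e'0) := cf _ Ux.
  by apply: filterS => y; rewrite distrC.
move=> /nbhs_ballP[r /= r0 Hr].
apply: filterS (nbhsx_ballx x _ r0) => y; rewrite -ball_normE /= distrC => xyr.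
(* the successive vertices of the box, from [x] to [y] *)
pose z (k : nat) : 'rV[R]_n := \row_i (if (i < k)%N then y 0 i else x 0 i).
have zS (k : 'I_n) : z k.+1 = (y 0 k - x 0 k) *: delta_mx 0 k + z k.
  apply/rowP => i; rewrite !mxE eqxx /= ltnS leq_eqVlt -(inj_eq val_inj).
  by case: (ltngtP i k) => //= [_|_|/val_inj->]; rewrite ?mulr0 ?add0r ?mulr1 ?subrK.
have Dz (k : 'I_n) :
    `|f (z k.+1) - f (z k) - partial k f x * (y 0 k - x 0 k)| <= e' * `|y - x|.
  have seg (t : R) : `|t| <= `|y 0 k - x 0 k| -> `|t *: delta_mx 0 k + z k - x| < r.
    move=> th; apply: le_lt_trans xyr; rewrite [leLHS]/Num.Def.normr/= mx_normrE.
    apply: bigmax_le => // -[i j] _; rewrite !mxE /= [i]ord1 eqxx /=.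
    have [->|jk] := eqVneq j k.
      rewrite ltnn mulr1 addrK; apply: le_trans th _.
      by have := coord_le_norm (y - x) 0 k; rewrite !mxE.
    rewrite mulr0 add0r; case: ifP => _; last by rewrite subrr normr0.
    by have := coord_le_norm (y - x) 0 j; rewrite !mxE.
  have [|t th E] := @mean_value_line f (z k) (delta_mx 0 k) (y 0 k - x 0 k).
    move=> t th; apply: (C1f k).1; apply: (Hr _ _).1; rewrite -ball_normE /= distrC seg//.
  rewrite -zS in E; rewrite E -mulrBl normrM.
  apply: ler_pM => //.
    by apply: (Hr _ _).2; rewrite -ball_normE /= distrC seg//.
  by have := coord_le_norm (y - x) 0 k; rewrite !mxE.
have z0 : z 0%N = x by apply/rowP => i; rewrite !mxE.
have zn : z n = y by apply/rowP => i; rewrite !mxE ltn_ord.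
have -> : f y - L y - (f x - L x) =
    \sum_(k < n) (f (z k.+1) - f (z k) - partial k f x * (y 0 k - x 0 k)).
  rewrite sumrB -(big_mkord xpredT (fun k => f (z k.+1) - f (z k))) telescope_sumr//.
  rewrite z0 zn (_ : \sum_i _ = L y - L x); first by ring.
  by rewrite -sumrB; apply: eq_bigr => i _; rewrite mulrBr.
apply: le_trans (ler_norm_sum _ _ _) _.
apply: le_trans (ler_sum _ (fun k _ => Dz k)) _.
rewrite sumr_const card_ord -[leLHS]mulr_natl mulrA ler_wpM2r//.
rewrite /e' mulrCA ger_pMr// ler_pdivrMr// mul1r ler_nat //.
Unshelve. all: by end_near.
Qed.

End Differentiability.

(** * Curvature of a warped product with a circle *)

Section ProductCoordinates.
Context (R : realType) (n : nat).
Implicit Types (U : set 'rV[R]_n) (f : 'rV[R]_n -> R) (i : 'I_n).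

Lemma sum_circle (F : 'I_(1 + n) -> R) :
  \sum_(p < 1 + n) F p = F (lshift n ord0) + \sum_(p < n) F (rshift 1 p).
Proof. by rewrite big_split_ord /= big_ord1. Qed.

Lemma rsubmx_delta_r i : rsubmx (delta_mx 0 (rshift 1 i) : 'rV[R]_(1 + n)) = delta_mx 0 i.
Proof. by apply/rowP => j; rewrite !mxE (inj_eq (@rshift_inj 1 n)). Qed.

Lemma rsubmx_delta_l (j : 'I_1) : rsubmx (delta_mx 0 (lshift n j) : 'rV[R]_(1 + n)) = 0.
Proof. by apply/rowP => k; rewrite !mxE eq_rlshift andbF. Qed.

Lemma derive_rsubmx f y (w : 'rV[R]_(1 + n)) :
  'D_w (f \o rsubmx) y = 'D_(rsubmx w) f (rsubmx y).
Proof.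
have E : (fun h : R => h^-1 *: (((f \o rsubmx) \o shift y) (h *: w)
      - (f \o rsubmx) y)) = (fun h => h^-1 *: ((f \o shift (rsubmx y))
      (h *: rsubmx w) - f (rsubmx y))).
  apply/funext => h /=.
  by rewrite [rsubmx (_ + _)]raddfD /= [rsubmx (h *: _)]linearZ.
by rewrite /derive E.
Qed.

Lemma partial_rsubmx_r f i (y : 'rV[R]_(1 + n)) :
  partial (rshift 1 i) (fun z => f (rsubmx z)) y = partial i f (rsubmx y).
Proof. by rewrite /partial (derive_rsubmx f) rsubmx_delta_r. Qed.

Lemma partial_rsubmx_l f (j : 'I_1) (y : 'rV[R]_(1 + n)) :
  partial (lshift n j) (fun z => f (rsubmx z)) y = 0.
Proof. by rewrite /partial (derive_rsubmx f) rsubmx_delta_l derive0. Qed.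

Lemma open_rsubmx U : open U -> open [set y : 'rV[R]_(1 + n) | U (rsubmx y)].
Proof. by move=> oU; apply: open_comp => // y _; exact: continuous_rsubmx. Qed.

(** Everything built from the warped metric depends on the base point only, but
    equals its base expression only where the metric is invertible; hence the
    hypothesis on the open set of such points. *)
Lemma partial_pull_r U f (F : 'rV[R]_(1 + n) -> R) i y : open U ->
  (forall z, U (rsubmx z) -> F z = f (rsubmx z)) -> U (rsubmx y) ->
  partial (rshift 1 i) F y = partial i f (rsubmx y).
Proof.
move=> oU Ff Uy; rewrite -partial_rsubmx_r.
exact: (@partial_on _ _ [set y | U (rsubmx y)]) (open_rsubmx oU) Uy Ff.
Qed.

Lemma partial_pull_l U f (F : 'rV[R]_(1 + n) -> R) j y : open U ->
  (forall z, U (rsubmx z) -> F z = f (rsubmx z)) -> U (rsubmx y) ->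
  partial (lshift n j) F y = 0.
Proof.
move=> oU Ff Uy; rewrite -(partial_rsubmx_l f j y).
exact: (@partial_on _ _ [set y | U (rsubmx y)]) (open_rsubmx oU) Uy Ff.
Qed.

End ProductCoordinates.

Section SmoothGeometry.
Context (R : realType) (n : nat) (G : 'rV[R]_n -> 'M[R]_n) (U : set 'rV[R]_n).
Hypotheses (oU : open U)
  (sG : forall i j, smooth_on U (fun x => G x i j))
  (uG : forall x, U x -> G x \in unitmx).

Lemma smooth_ginv i j : smooth_on U (ginv G i j).
Proof. exact: smooth_on_invmx. Qed.

Lemma smooth_christoffel k i j : smooth_on U (christoffel G k i j).
Proof.
apply: smooth_on_mul => //; first exact: smooth_on_cst.
apply: smooth_on_sum => // l; apply: smooth_on_mul => //; first exact: smooth_ginv.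
apply: smooth_on_add => //; first apply: smooth_on_add => //.
- exact/smooth_on_partial/sG.
- exact/smooth_on_partial/sG.
- apply: smooth_on_opp => //; exact/smooth_on_partial/sG.
Qed.

Lemma smooth_laplacian f : smooth_on U f -> smooth_on U (laplacian G f).
Proof.
move=> sf; apply: smooth_on_sum => // i; apply: smooth_on_sum => // j.
apply: smooth_on_mul => //; first exact: smooth_ginv.
apply: smooth_on_add => //; first by do 2 apply: smooth_on_partial.
apply: smooth_on_opp => //; apply: smooth_on_sum => // k.
by apply: smooth_on_mul => //; [exact: smooth_christoffel|exact: smooth_on_partial].
Qed.

End SmoothGeometry.

(** The metric [v ^+ 2 dt^2 + G] on the product of a line with a domain of
    'rV_n.  Below, [o] is the circle direction and [r i] the [i]-th base
    direction, and the names of the local facts list the kinds of the indices: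
    [Hor] is the entry ([o], [r i]) of [H], [dHor] its derivatives, [Ior] that
    entry of the inverse, [Coor] a Christoffel symbol. *)
Section Warped.
Context (R : realType) (n : nat) (G : 'rV[R]_n -> 'M[R]_n) (v : 'rV[R]_n -> R)
  (U : set 'rV[R]_n).
Hypotheses (oU : open U)
  (sG : forall i j, smooth_on U (fun x => G x i j))
  (symG : forall x, U x -> (G x)^T = G x)
  (uG : forall x, U x -> G x \in unitmx)
  (sv : smooth_on U v) (v0 : forall x, U x -> v x != 0).

Context (H : 'rV[R]_(1 + n) -> 'M[R]_(1 + n)).
Hypothesis HE : forall y,
  H y = block_mx (v (rsubmx y) ^+ 2)%:M 0 0 (G (rsubmx y)).

Local Notation o := (lshift n (@ord0 0)).
Local Notation r := (@rshift 1 n).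

Let Hoo y : H y o o = v (rsubmx y) ^+ 2.
Proof. by rewrite HE block_mxEul !mxE. Qed.
Let Hor y i : H y o (r i) = 0.
Proof. by rewrite HE block_mxEur !mxE. Qed.
Let Hro y i : H y (r i) o = 0.
Proof. by rewrite HE block_mxEdl !mxE. Qed.
Let Hrr y i j : H y (r i) (r j) = G (rsubmx y) i j.
Proof. by rewrite HE block_mxEdr. Qed.

Let derivable_v x i : U x -> derivable v x (delta_mx 0 i).
Proof. exact: smooth_on_derivable. Qed.

Let dHo i j y : partial o (fun z => H z i j) y = 0.
Proof.
rewrite (_ : (fun z => H z i j) =
  (fun z => block_mx (v (rsubmx z) ^+ 2)%:M 0 0 (G (rsubmx z)) i j)).
  exact: (@partial_rsubmx_l R n (fun x => block_mx (v x ^+ 2)%:M 0 0 (G x) i j)).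
by apply/funext => z; rewrite HE.
Qed.
Let dHoo i y : U (rsubmx y) ->
  partial (r i) (fun z => H z o o) y = 2 * v (rsubmx y) * partial i v (rsubmx y).
Proof.
move=> Uy; rewrite (_ : (fun z => H z o o) = fun z => v (rsubmx z) * v (rsubmx z)); last first.
  by apply/funext => z; rewrite Hoo expr2.
rewrite (partial_rsubmx_r (fun x => v x * v x)) partialM//;
  [ring|exact: derivable_v|exact: derivable_v].
Qed.
Let dHor i j y : partial (r i) (fun z => H z o (r j)) y = 0.
Proof.
rewrite (_ : (fun z => H z o (r j)) = cst 0); first exact: derive_cst.
by apply/funext => z; rewrite Hor.
Qed.
Let dHro i j y : partial (r i) (fun z => H z (r j) o) y = 0.
Proof.
rewrite (_ : (fun z => H z (r j) o) = cst 0); first exact: derive_cst.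
by apply/funext => z; rewrite Hro.
Qed.
Let dHrr i j k y : partial (r i) (fun z => H z (r j) (r k)) y =
  partial i (fun x => G x j k) (rsubmx y).
Proof.
rewrite -(partial_rsubmx_r (fun x => G x j k)); congr (partial _ _ _).
by apply/funext => z; rewrite Hrr.
Qed.

Lemma invmx_warped y : U (rsubmx y) ->
  invmx (H y) = block_mx (v (rsubmx y) ^- 2)%:M 0 0 (invmx (G (rsubmx y))).
Proof.
move=> Uy.
have uv : (v (rsubmx y) ^+ 2)%:M \in (@unitmx R 1).
  by rewrite unitmxE det_scalar unitfE expf_neq0// expf_neq0// v0.
rewrite HE invmx_block_diag ?invmx_scalar//.
by rewrite block_diag_mx_unit uv uG.
Qed.

Let Ioo y : U (rsubmx y) -> ginv H o o y = v (rsubmx y) ^- 2.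
Proof. by move=> Uy; rewrite /ginv invmx_warped// block_mxEul !mxE. Qed.
Let Ior y i : U (rsubmx y) -> ginv H o (r i) y = 0.
Proof. by move=> Uy; rewrite /ginv invmx_warped// block_mxEur !mxE. Qed.
Let Iro y i : U (rsubmx y) -> ginv H (r i) o y = 0.
Proof. by move=> Uy; rewrite /ginv invmx_warped// block_mxEdl !mxE. Qed.
Let Irr y i j : U (rsubmx y) -> ginv H (r i) (r j) y = ginv G i j (rsubmx y).
Proof. by move=> Uy; rewrite /ginv invmx_warped// block_mxEdr. Qed.

(** The components of the gradient of [v]. *)
Let w m x := \sum_(l < n) ginv G m l x * partial l v x.

Let Crrr k i j y : U (rsubmx y) ->
  christoffel H (r k) (r i) (r j) y = christoffel G k i j (rsubmx y).
Proof.
move=> Uy; rewrite /christoffel sum_circle Iro// mul0r add0r.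
by congr (_ * _); apply: eq_bigr => l _; rewrite Irr// !dHrr.
Qed.
Let Crro k i y : U (rsubmx y) -> christoffel H (r k) (r i) o y = 0.
Proof.
move=> Uy; rewrite /christoffel sum_circle Iro// mul0r add0r big1 ?mulr0// => l _.
by rewrite dHor dHo dHro addr0 subr0 mulr0.
Qed.
Let Cror k i y : U (rsubmx y) -> christoffel H (r k) o (r i) y = 0.
Proof.
move=> Uy; rewrite /christoffel sum_circle Iro// mul0r add0r big1 ?mulr0// => l _.
by rewrite dHor dHo dHor addr0 subr0 mulr0.
Qed.
Let Croo k y : U (rsubmx y) ->
  christoffel H (r k) o o y = - v (rsubmx y) * w k (rsubmx y).
Proof.
move=> Uy; rewrite /christoffel sum_circle Iro// mul0r add0r /w !mulr_sumr.
apply: eq_bigr => l _; rewrite Irr// !dHo dHoo// addr0 sub0r.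
by field.
Qed.
Let Corr i j y : U (rsubmx y) -> christoffel H o (r i) (r j) y = 0.
Proof.
move=> Uy; rewrite /christoffel sum_circle dHro dHro dHo addr0 subr0 mulr0 add0r.
by rewrite big1 ?mulr0// => l _; rewrite Ior// mul0r.
Qed.
Let Coor i y : U (rsubmx y) ->
  christoffel H o o (r i) y = (v (rsubmx y))^-1 * partial i v (rsubmx y).
Proof.
move=> Uy; rewrite /christoffel sum_circle !dHo dHoo// Ioo// add0r subr0.
rewrite big1 ?addr0 => [|l _]; last by rewrite Ior// mul0r.
by field; rewrite v0.
Qed.
Let Coro i y : U (rsubmx y) ->
  christoffel H o (r i) o y = (v (rsubmx y))^-1 * partial i v (rsubmx y).
Proof.
move=> Uy; rewrite /christoffel sum_circle !dHo dHoo// Ioo// addr0 subr0.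
rewrite big1 ?addr0 => [|l _]; last by rewrite Ior// mul0r.
by field; rewrite v0.
Qed.
Let Cooo y : U (rsubmx y) -> christoffel H o o o y = 0.
Proof.
move=> Uy; rewrite /christoffel sum_circle !dHo addr0 subr0 mulr0 add0r.
by rewrite big1 ?mulr0// => l _; rewrite Ior// mul0r.
Qed.

(** Every Christoffel symbol with exactly one circle index is zero (the base is
    totally geodesic), so no circle term enters. *)
Lemma riemann_warped i j k l y : U (rsubmx y) ->
  riemann H (r i) (r j) (r k) (r l) y = riemann G i j k l (rsubmx y).
Proof.
move=> Uy; rewrite /riemann sum_circle Hro mul0r add0r.
apply: eq_bigr => m _; rewrite Hrr; congr (_ * (_ - _ + _)).
- by apply: partial_pull_r oU _ Uy => z; exact: Crrr.
- by apply: partial_pull_r oU _ Uy => z; exact: Crrr.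
rewrite sum_circle !Crro// !mul0r subr0 add0r.
by apply: eq_bigr => p _; rewrite !Crrr.
Qed.

(** The Christoffel symbol [Coor] is d_l log v; its derivative in the direction
    [r j], its square and its covariant correction combine into the hessian of
    [v] over [v]. *)
Lemma riemann_warped_circle j l y : U (rsubmx y) ->
  riemann H o (r j) o (r l) y =
    - v (rsubmx y) * hessian G v j l (rsubmx y).
Proof.
move=> Uy; rewrite /riemann sum_circle Hoo [X in _ + X]big1 ?addr0 => [|m _]; last first.
  by rewrite Hor mul0r.
have -> : partial o (christoffel H o (r j) (r l)) y = 0.
  apply: (@partial_pull_l _ _ _ (fun=> 0) _ _ _ oU _ Uy) => z; exact: Corr.
have -> : partial (r j) (christoffel H o o (r l)) y =
    partial j (fun x => (v x)^-1 * partial l v x) (rsubmx y).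
  by apply: partial_pull_r oU _ Uy => z; exact: Coor.
set x := rsubmx y in Uy *.
have v0x := v0 Uy.
rewrite sum_circle Cooo// Corr// Coro// Coor// mulr0 sub0r add0r.
under eq_bigr => p _ do rewrite Coor// Corr// mul0r subr0 Crrr//.
rewrite partialM; last 2 first.
- by apply: derivableV => //; exact: derivable_v.
- by apply: (smooth_on_derivable (U := U)) => //; exact: smooth_on_partial.
rewrite partialV//; last exact: derivable_v.
rewrite /hessian -/x.
under eq_bigr do rewrite -mulrA [partial _ _ _ * _]mulrC.
rewrite -mulr_sumr; field; exact: v0x.
Qed.

Let G_ginv k l x : U x -> \sum_(m < n) G x k m * ginv G m l x = (k == l)%:R.
Proof. by move=> Ux; have /matrixP/(_ k l) := mulmxV (uG Ux); rewrite !mxE. Qed.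

Let lowered_christoffel k i j x : U x ->
  \sum_(m < n) G x k m * christoffel G m i j x =
  2^-1 * (partial i (fun y => G y j k) x + partial j (fun y => G y i k) x
     - partial k (fun y => G y i j) x).
Proof.
move=> Ux; rewrite /christoffel.
under eq_bigr do rewrite mulrCA mulr_sumr.
rewrite -mulr_sumr exchange_big /=; congr (_ * _).
under eq_bigr do (under eq_bigr do rewrite mulrA; rewrite -mulr_suml).
rewrite (bigD1 k)//= G_ginv// eqxx mul1r big1 ?addr0// => l lk.
by rewrite G_ginv// eq_sym (negPf lk) mul0r.
Qed.

Lemma ginv_sym i j x : U x -> ginv G i j x = ginv G j i x.
Proof.
by move=> Ux; rewrite /ginv -[in RHS](symG Ux) -trmx_inv mxE.
Qed.

Let partialG_sym k i j x : U x ->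
  partial k (fun y => G y i j) x = partial k (fun y => G y j i) x.
Proof.
by move=> Ux; apply: partial_on oU Ux _ => z Uz; rewrite -[in LHS](symG Uz) mxE.
Qed.

Let Gw k x : U x -> \sum_(m < n) G x k m * w m x = partial k v x.
Proof.
move=> Ux; rewrite /w.
under eq_bigr do rewrite mulr_sumr.
rewrite exchange_big /=.
under eq_bigr do (under eq_bigr do rewrite mulrA; rewrite -mulr_suml).
rewrite (bigD1 k)//= G_ginv// eqxx mul1r big1 ?addr0// => l lk.
by rewrite G_ginv// eq_sym (negPf lk) mul0r.
Qed.

Let smooth_w m : smooth_on U (w m).
Proof.
apply: smooth_on_sum => // l; apply: smooth_on_mul => //; first exact: smooth_ginv.
exact: smooth_on_partial.
Qed.

Let partial_sum (F : 'I_n -> 'rV[R]_n -> R) i x : U x ->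
  (forall m, smooth_on U (F m)) ->
  partial i (fun y => \sum_(m < n) F m y) x = \sum_(m < n) partial i (F m) x.
Proof.
move=> Ux sF.
rewrite (_ : (fun y => _) = \sum_(m < n) F m); last first.
  by apply/funext => y; rewrite fct_sumE.
by rewrite /partial derive_sum// => m; apply: smooth_on_derivable (sF m) Ux.
Qed.

(** Lowering an index commutes with the covariant derivative.  It is obtained
    by differentiating [G w = dv], so the derivative of the inverse matrix is
    never computed. *)
Let hessian_w i k x : U x ->
  \sum_(m < n) G x k m * (partial i (w m) x
    + \sum_(p < n) christoffel G m i p x * w p x) = hessian G v i k x.
Proof.
move=> Ux.
have Gw' : \sum_(m < n) G x k m * partial i (w m) x =
    partial i (partial k v) x - \sum_(m < n) partial i (fun y => G y k m) x * w m x.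
  rewrite -(partial_on i oU Ux (Gw k)) partial_sum//; last first.
    by move=> m; apply: smooth_on_mul.
  rewrite -sumrB; apply: eq_bigr => m _.
  rewrite partialM; [ring| |].
  - exact: smooth_on_derivable (sG k m) Ux.
  - exact: smooth_on_derivable (smooth_w m) Ux.
under eq_bigr do rewrite mulrDr.
rewrite big_split /= Gw' /hessian -addrA; congr (_ + _).
have -> : \sum_(m < n) G x k m * (\sum_(p < n) christoffel G m i p x * w p x) =
    \sum_(p < n) (\sum_(m < n) G x k m * christoffel G m i p x) * w p x.
  under eq_bigr do rewrite mulr_sumr.
  rewrite exchange_big /=; apply: eq_bigr => p _; rewrite mulr_suml.
  by apply: eq_bigr => m _; rewrite mulrA.
have -> : \sum_(l < n) christoffel G l i k x * partial l v x =
    \sum_(p < n) (\sum_(m < n) G x p m * christoffel G m i k x) * w p x.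
  under [RHS]eq_bigr do rewrite lowered_christoffel//.
  rewrite /w; under [RHS]eq_bigr do rewrite mulr_sumr.
  rewrite exchange_big /=; apply: eq_bigr => l _.
  rewrite /christoffel mulr_sumr mulr_suml; apply: eq_bigr => p _.
  by rewrite (ginv_sym p l Ux); ring.
rewrite -sumrN -sumrN -big_split /=; apply: eq_bigr => p _.
rewrite !lowered_christoffel// (partialG_sym i k p Ux) (partialG_sym k i p Ux).
by field.
Qed.

(** The same component of the curvature as in [riemann_warped_circle], up to
    the pair symmetry; computing it directly from [hessian_w] is shorter than
    proving that symmetry. *)
Lemma riemann_warped_mixed i k y : U (rsubmx y) ->
  riemann H (r i) o (r k) o y = - v (rsubmx y) * hessian G v i k (rsubmx y).
Proof.
move=> Uy; rewrite /riemann sum_circle Hro mul0r add0r -hessian_w// mulr_sumr.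
apply: eq_bigr => m _; rewrite Hrr mulrCA; congr (_ * _).
have -> : partial (r i) (christoffel H (r m) o o) y =
    partial i (fun x => - v x * w m x) (rsubmx y).
  by apply: partial_pull_r oU _ Uy => z; exact: Croo.
have -> : partial o (christoffel H (r m) (r i) o) y = 0.
  by apply: (@partial_pull_l _ _ _ (fun=> 0) _ _ _ oU _ Uy) => z; exact: Crro.
set x := rsubmx y in Uy *.
rewrite sum_circle Crro// Croo// Coro// mul0r.
under eq_bigr => p _ do rewrite Crrr// Croo// Cror// mul0r subr0 mulrCA.
rewrite -mulr_sumr partialM; last 2 first.
- by apply: derivableN; exact: derivable_v.
- exact: smooth_on_derivable (smooth_w m) Uy.
rewrite partialN; last exact: derivable_v.
rewrite -/x; field; exact: v0.
Qed.

Lemma ricci_warped j l y : U (rsubmx y) ->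
  ricci H (r j) (r l) y = ricci G j l (rsubmx y)
    - (v (rsubmx y))^-1 * hessian G v j l (rsubmx y).
Proof.
move=> Uy; rewrite /ricci sum_circle sum_circle Ioo// riemann_warped_circle//.
rewrite big1 ?addr0 => [|k _]; last by rewrite Ior// mul0r.
rewrite addrC; congr (_ + _); last by field; exact: v0.
apply: eq_bigr => i _; rewrite sum_circle Iro// mul0r add0r.
by apply: eq_bigr => k _; rewrite Irr// riemann_warped.
Qed.

Lemma ricci_warped_circle y : U (rsubmx y) ->
  ricci H o o y = - v (rsubmx y) * laplacian G v (rsubmx y).
Proof.
move=> Uy; rewrite /ricci sum_circle sum_circle.
have -> : riemann H o o o o y = 0.
  rewrite /riemann big1// => m _; rewrite subrr add0r big1 ?mulr0// => p _.
  by rewrite subrr.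
rewrite mulr0 add0r big1 ?add0r => [|k _]; last by rewrite Ior// mul0r.
rewrite /laplacian mulr_sumr; apply: eq_bigr => i _.
rewrite sum_circle Iro// mul0r add0r mulr_sumr.
by apply: eq_bigr => k _; rewrite Irr// riemann_warped_mixed// mulrCA.
Qed.

(** Again the symbols with exactly one circle index are zero, so only the base
    block of the Ricci tensor enters. *)
Lemma cov_ricci_warped k i j y : U (rsubmx y) ->
  cov_tensor2 H (ricci H) (r k) (r i) (r j) y =
  cov_tensor2 G (fun i j x => ricci G i j x - (v x)^-1 * hessian G v i j x)
    k i j (rsubmx y).
Proof.
move=> Uy; rewrite /cov_tensor2; congr (_ - _ - _).
- by apply: partial_pull_r oU _ Uy => z; exact: ricci_warped.
- rewrite sum_circle Corr// mul0r add0r; apply: eq_bigr => m _.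
  by rewrite Crrr// ricci_warped.
- rewrite sum_circle Corr// mul0r add0r; apply: eq_bigr => m _.
  by rewrite Crrr// ricci_warped.
Qed.

(** With f = (laplacian v) / v the circle component of the Ricci tensor is
    - v^2 f, and v^2 is the circle component of the metric, which is parallel:
    only the derivative of f is left. *)
Lemma cov_ricci_warped_circle k y : U (rsubmx y) ->
  cov_tensor2 H (ricci H) (r k) o o y =
  - v (rsubmx y) ^+ 2 *
    partial k (fun x => (v x)^-1 * laplacian G v x) (rsubmx y).
Proof.
move=> Uy; rewrite /cov_tensor2.
have -> : partial (r k) (ricci H o o) y =
    partial k (fun x => - v x * laplacian G v x) (rsubmx y).
  by apply: partial_pull_r oU _ Uy => z; exact: ricci_warped_circle.
have S1 (T : 'I_(1 + n) -> R) :
    \sum_(m < 1 + n) christoffel H m (r k) o y * T m =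
    (v (rsubmx y))^-1 * partial k v (rsubmx y) * T o.
  rewrite sum_circle (Coro k Uy) [X in _ + X]big1 ?addr0// => m _.
  by rewrite (Crro _ _ Uy) mul0r.
rewrite (S1 (fun m => ricci H m o y)) (S1 (fun m => ricci H o m y)).
rewrite (ricci_warped_circle Uy).
set x := rsubmx y in Uy *.
have dl := smooth_on_derivable (i := k) (smooth_laplacian oU sG uG sv) Uy.
have dv : derivable v x (delta_mx 0 k) by exact: derivable_v.
have dNv : derivable (fun x => - v x) x (delta_mx 0 k) by exact: derivableN.
have dVv : derivable (fun x => (v x)^-1) x (delta_mx 0 k).
  exact: derivableV (v0 Uy) dv.
rewrite (partialM dNv dl) (partialM dVv dl) (partialN dv) (partialV (v0 Uy) dv).
field; exact: v0.
Qed.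

(** The hyperbolic model in dimension n + 1 has Ricci tensor - n times the
    metric, so the trace of the difference of curvatures is Ric + n h. *)
Lemma trace_curvature_warped j l y : U (rsubmx y) ->
  \sum_i \sum_k ginv H i k y * (riemann H i (r j) k (r l) y
     - hyperbolic H i (r j) k (r l) y) =
  ricci G j l (rsubmx y) + n%:R * G (rsubmx y) j l
    - (v (rsubmx y))^-1 * hessian G v j l (rsubmx y).
Proof.
move=> Uy.
have uH : H y \in unitmx.
  rewrite HE block_diag_mx_unit uG// andbT unitmxE det_scalar unitfE.
  by rewrite !expf_neq0// v0.
have symI i k : ginv H i k y = ginv H k i y.
  have symH : (H y)^T = H y by rewrite HE tr_block_mx !trmx0 symG// tr_scalar_mx.
  by rewrite /ginv -[in RHS]symH -trmx_inv mxE.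
have tr1 : \sum_i \sum_k ginv H i k y * (H y i k * H y (r j) (r l)) =
    n.+1%:R * H y (r j) (r l).
  under eq_bigr do (under eq_bigr do rewrite mulrA; rewrite -mulr_suml).
  rewrite -mulr_suml; congr (_ * _).
  have -> : n.+1%:R = \tr (1%:M : 'M[R]_(1 + n)) by rewrite mxtrace1.
  rewrite -(mulVmx uH); apply: eq_bigr => i _; rewrite mxE.
  have symH : (H y)^T = H y by rewrite HE tr_block_mx !trmx0 symG// tr_scalar_mx.
  by apply: eq_bigr => k _; rewrite -[in LHS]symH mxE.
have tr2 : \sum_i \sum_k ginv H i k y * (H y i (r l) * H y (r j) k) = H y (r j) (r l).
  have /matrixP/(_ (r j) (r l)) : H y *m invmx (H y) *m H y = H y.
    by rewrite mulmxV// mul1mx.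
  rewrite mxE => E; rewrite -[RHS]E; apply: eq_bigr => i _.
  rewrite [(H y *m _) _ _]mxE mulr_suml; apply: eq_bigr => k _.
  by rewrite symI /ginv; ring.
have := ricci_warped j l Uy; rewrite /ricci => Hric.
rewrite addrAC -Hric -[in RHS]Hrr.
rewrite (_ : n%:R * _ = n.+1%:R * H y (r j) (r l) - H y (r j) (r l)); last first.
  by rewrite -natr1; ring.
rewrite -tr1 -[X in _ - X]tr2 -sumrB -big_split /=; apply: eq_bigr => i _.
rewrite -sumrB -big_split /=; apply: eq_bigr => k _.
rewrite /hyperbolic; ring.
Qed.

End Warped.

(** * Norms of tensors in orthonormal frames *)

Section TensorNorms.
Context (R : realType).

Section Frame.
Context (n m : nat) (S : 'M[R]_(n, m)).

(** Components of a covariant tensor in the frame whose vectors are the columns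
    of [S].  The frame is orthonormal when [S *m S^T] is the inverse metric. *)
Definition frame1 (T : 'I_n -> R) (a : 'I_m) : R := \sum_i S i a * T i.
Definition frame2 (T : 'I_n -> 'I_n -> R) a b :=
  frame1 (fun i => frame1 (T i) b) a.
Definition frame3 (T : 'I_n -> 'I_n -> 'I_n -> R) a b c :=
  frame1 (fun i => frame2 (T i) b c) a.
Definition frame4 (T : 'I_n -> 'I_n -> 'I_n -> 'I_n -> R) a b c d :=
  frame1 (fun i => frame3 (T i) b c d) a.

Lemma frame1_sum (I : Type) (s : seq I) (F : I -> 'I_n -> R) a :
  frame1 (fun i => \sum_(p <- s) F p i) a = \sum_(p <- s) frame1 (F p) a.
Proof.
rewrite /frame1; under eq_bigr do rewrite mulr_sumr.
exact: exchange_big.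
Qed.

Lemma frame1Z (c : R) (T : 'I_n -> R) a :
  frame1 (fun i => c * T i) a = c * frame1 T a.
Proof. by rewrite /frame1 mulr_sumr; apply: eq_bigr => i _; rewrite mulrCA. Qed.

Let g := S *m S^T.

(** Contracting with the inverse metric is the Euclidean product of the
    components in an orthonormal frame; the versions of higher rank iterate this
    one index at a time. *)
Lemma gram_frame (T T' : 'I_n -> R) :
  \sum_i \sum_i' g i i' * (T i * T' i') = \sum_a frame1 T a * frame1 T' a.
Proof.
under eq_bigr => i _ do under eq_bigr => i' _ do rewrite /g mxE mulr_suml.
under eq_bigr do rewrite exchange_big.
rewrite exchange_big; apply: eq_bigr => a _ /=.
rewrite /frame1 mulr_suml; apply: eq_bigr => i _.
by rewrite mulr_sumr; apply: eq_bigr => i' _; rewrite mxE; ring.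
Qed.

Lemma gram_frame_sum (I : finType) (X X' : 'I_n -> I -> R) :
  \sum_i \sum_i' g i i' * (\sum_b X i b * X' i' b) =
  \sum_a \sum_b frame1 (X^~ b) a * frame1 (X'^~ b) a.
Proof.
under eq_bigr => i _ do under eq_bigr => i' _ do rewrite mulr_sumr.
under eq_bigr do rewrite exchange_big.
rewrite exchange_big [RHS]exchange_big; apply: eq_bigr => b _.
exact: gram_frame.
Qed.

Lemma gram_frame2 (T T' : 'I_n -> 'I_n -> R) :
  \sum_i \sum_i' \sum_j \sum_j' g i i' * g j j' * (T i j * T' i' j') =
  \sum_a \sum_b frame2 T a b * frame2 T' a b.
Proof.
rewrite -gram_frame_sum; apply: eq_bigr => i _; apply: eq_bigr => i' _.
rewrite -gram_frame !mulr_sumr; apply: eq_bigr => j _.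
by rewrite mulr_sumr; apply: eq_bigr => j' _; ring.
Qed.

Lemma gram_frame3 (T T' : 'I_n -> 'I_n -> 'I_n -> R) :
  \sum_i \sum_i' \sum_j \sum_j' \sum_k \sum_k'
    g i i' * g j j' * g k k' * (T i j k * T' i' j' k') =
  \sum_a \sum_b \sum_c frame3 T a b c * frame3 T' a b c.
Proof.
under [RHS]eq_bigr do rewrite pair_bigA.
rewrite -(gram_frame_sum (fun i (p : 'I_m * 'I_m) => frame2 (T i) p.1 p.2)
  (fun i p => frame2 (T' i) p.1 p.2)).
apply: eq_bigr => i _; apply: eq_bigr => i' _.
rewrite -(pair_bigA _ (fun b c => frame2 (T i) b c * frame2 (T' i') b c)).
rewrite -gram_frame2 !mulr_sumr.
do 3 (apply: eq_bigr => ? _; rewrite !mulr_sumr).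
by apply: eq_bigr => ? _; ring.
Qed.

Lemma gram_frame4 (T T' : 'I_n -> 'I_n -> 'I_n -> 'I_n -> R) :
  \sum_i \sum_i' \sum_j \sum_j' \sum_k \sum_k' \sum_l \sum_l'
    g i i' * g j j' * g k k' * g l l' * (T i j k l * T' i' j' k' l') =
  \sum_a \sum_b \sum_c \sum_d frame4 T a b c d * frame4 T' a b c d.
Proof.
under [RHS]eq_bigr do (under eq_bigr do rewrite pair_bigA; rewrite pair_bigA).
rewrite -(gram_frame_sum
  (fun i (p : 'I_m * ('I_m * 'I_m)) => frame3 (T i) p.1 p.2.1 p.2.2)
  (fun i p => frame3 (T' i) p.1 p.2.1 p.2.2)).
apply: eq_bigr => i _; apply: eq_bigr => i' _.
rewrite -(pair_bigA _ (fun b (p : 'I_m * 'I_m) =>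
  frame3 (T i) b p.1 p.2 * frame3 (T' i') b p.1 p.2)).
under [X in _ = _ * X]eq_bigr => b _ do
  rewrite -(pair_bigA _ (fun c d => frame3 (T i) b c d * frame3 (T' i') b c d)).
rewrite -gram_frame3 !mulr_sumr.
do 5 (apply: eq_bigr => ? _; rewrite !mulr_sumr).
by apply: eq_bigr => ? _; ring.
Qed.

End Frame.

Section FrameNorms.
Context (n m : nat) (G : 'rV[R]_n -> 'M[R]_n) (S : 'M[R]_(n, m)) (x : 'rV[R]_n).
Hypothesis GS : invmx (G x) = S *m S^T.

Lemma norm1_frame T : norm1 G T x =
  Num.sqrt (\sum_a frame1 S (fun i => T i x) a ^+ 2).
Proof.
congr Num.sqrt; under [RHS]eq_bigr do rewrite expr2.
rewrite -gram_frame; apply: eq_bigr => i _; apply: eq_bigr => i' _.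
by rewrite /ginv GS mulrA.
Qed.

Lemma norm2_frame T : norm2 G T x =
  Num.sqrt (\sum_a \sum_b frame2 S (fun i j => T i j x) a b ^+ 2).
Proof.
congr Num.sqrt; under [RHS]eq_bigr do under eq_bigr do rewrite expr2.
rewrite -gram_frame2; do 4 apply: eq_bigr => ? _.
by rewrite /ginv GS !mulrA.
Qed.

Lemma norm3_frame T : norm3 G T x =
  Num.sqrt (\sum_a \sum_b \sum_c frame3 S (fun i j k => T i j k x) a b c ^+ 2).
Proof.
congr Num.sqrt.
under [RHS]eq_bigr do under eq_bigr do under eq_bigr do rewrite expr2.
rewrite -gram_frame3; do 6 apply: eq_bigr => ? _.
by rewrite /ginv GS !mulrA.
Qed.

Lemma norm4_frame T : norm4 G T x =
  Num.sqrt (\sum_a \sum_b \sum_c \sum_d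
    frame4 S (fun i j k l => T i j k l x) a b c d ^+ 2).
Proof.
congr Num.sqrt.
under [RHS]eq_bigr do under eq_bigr do under eq_bigr do under eq_bigr do rewrite expr2.
rewrite -gram_frame4; do 8 apply: eq_bigr => ? _.
by rewrite /ginv GS !mulrA.
Qed.

Lemma sum_sqr_le (F : 'I_m -> R) :
  (\sum_a F a) ^+ 2 <= m%:R * \sum_a F a ^+ 2.
Proof.
have : 0 <= \sum_a \sum_b (F a - F b) ^+ 2.
  by apply: sumr_ge0 => a _; apply: sumr_ge0 => b _; exact: sqr_ge0.
have -> : \sum_a \sum_b (F a - F b) ^+ 2 =
    2 * (m%:R * (\sum_a F a ^+ 2) - (\sum_a F a) ^+ 2).
  have -> : \sum_a \sum_b (F a - F b) ^+ 2 =
      \sum_a (F a ^+ 2 * m%:R + - 2 * F a * (\sum_b F b) + \sum_b F b ^+ 2).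
    apply: eq_bigr => a _.
    rewrite mulr_natr -[X in _ *+ X](card_ord m) -sumr_const mulr_sumr.
    by rewrite -!big_split /=; apply: eq_bigr => b _; ring.
  rewrite !big_split /= -mulr_suml -mulr_suml -mulr_sumr.
  rewrite sumr_const card_ord -[_ *+ m]mulr_natr; ring.
by rewrite pmulr_rge0// subr_ge0.
Qed.

(** In an orthonormal frame the trace is a sum of [m] components, and the
    Cauchy-Schwarz inequality bounds its square by [m] times the sum of their
    squares, which is part of the full norm. *)
Lemma norm2_trace_le (T : 'I_n -> 'I_n -> 'I_n -> 'I_n -> 'rV[R]_n -> R) :
  norm2 G (fun j l y => \sum_i \sum_k ginv G i k y * T i j k l y) x <=
  Num.sqrt m%:R * norm4 G T x.
Proof.
rewrite norm2_frame norm4_frame -sqrtrM// ler_sqrt; last first.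
  by apply: mulr_ge0 => //; do 4 (apply: sumr_ge0 => ? _); exact: sqr_ge0.
set F := frame4 S _.
have FE b d : frame2 S (fun j l => \sum_i \sum_k ginv G i k x * T i j k l x) b d =
    \sum_a F a b a d.
  transitivity (\sum_i \sum_k ginv G i k x * frame2 S (fun j l => T i j k l x) b d).
    have E j : frame1 S (fun l => \sum_i \sum_k ginv G i k x * T i j k l x) d =
        \sum_i \sum_k ginv G i k x * frame1 S (fun l => T i j k l x) d.
      rewrite frame1_sum; apply: eq_bigr => i _.
      by rewrite frame1_sum; apply: eq_bigr => k _; rewrite frame1Z.
    rewrite /frame2 (funext E) frame1_sum; apply: eq_bigr => i _.
    by rewrite frame1_sum; apply: eq_bigr => k _; rewrite frame1Z.
  rewrite /ginv GS.
  under eq_bigr => i _ do under eq_bigr => k _ do rewrite mxE mulr_suml.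
  under eq_bigr do rewrite exchange_big.
  rewrite exchange_big; apply: eq_bigr => a _ /=.
  rewrite {1}/F /frame4 /frame1; apply: eq_bigr => i _.
  rewrite /frame3 /frame2 /frame1.
  under eq_bigr do rewrite mxE -mulrA.
  rewrite -mulr_sumr; congr (_ * _).
  under eq_bigr do rewrite mulr_sumr.
  rewrite exchange_big; apply: eq_bigr => j _ /=.
  rewrite mulr_sumr; apply: eq_bigr => k _; ring.
under eq_bigr do under eq_bigr do rewrite FE.
apply: le_trans (_ : \sum_b \sum_d m%:R * \sum_a F a b a d ^+ 2 <= _).
  by do 2 (apply: ler_sum => ? _); exact: sum_sqr_le.
under eq_bigr do (under eq_bigr do rewrite mulr_sumr; rewrite exchange_big).
rewrite exchange_big mulr_sumr; apply: ler_sum => a _ /=.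
rewrite mulr_sumr; apply: ler_sum => b _.
rewrite -mulr_sumr ler_wpM2l//.
rewrite [leRHS](bigD1 a)//= lerDl.
by do 2 (apply: sumr_ge0 => ? _); exact: sqr_ge0.
Qed.

End FrameNorms.

(** Cholesky decomposition, by induction through the Schur complement of the
    upper left entry. *)
Lemma posdef_factor n (B : 'M[R]_n) : B^T = B ->
  (forall u : 'rV_n, u != 0 -> 0 < (u *m B *m u^T) 0 0) ->
  exists S : 'M[R]_n, B = S *m S^T.
Proof.
elim: n B => [|n IH] B symB posB.
  by exists 0; apply/matrixP => -[].
rewrite -[n.+1]/(1 + n)%N in B symB posB *.
pose a := B 0 0; pose b : 'cV[R]_n := dlsubmx B; pose D : 'M[R]_n := drsubmx B.
have aE : ulsubmx B = a%:M by rewrite [LHS]mx11_scalar !mxE lshift0.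
have bE : ursubmx B = b^T by rewrite trmx_dlsub symB.
have BE : B = block_mx a%:M b^T b D by rewrite -aE -bE submxK.
have a0 : 0 < a.
  have := posB (row_mx 1%:M 0); rewrite BE mul_row_block tr_row_mx mul_row_col.
  rewrite trmx0 !mulmx0 mul0mx !addr0 trmx1 mulmx1 mul1mx mxE eqxx mulr1n; apply.
  apply/negP => /eqP/rowP/(_ 0); rewrite -(lshift0 n 0) row_mxEl !mxE eqxx.
  by move/eqP; rewrite oner_eq0.
have symD : D^T = D by rewrite trmx_drsub symB.
pose D' := D - a^-1 *: (b *m b^T).
have [||S' D'E] := IH D'.
- by rewrite /D' linearB /= linearZ /= trmx_mul trmxK symD.
(* [t] minimizes the quadratic form of [B] among the rows (t, u), and the
   minimum is the value of the Schur complement at [u] *)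
- move=> u u0; pose t := - a^-1 *: (u *m b).
  have := posB (row_mx t u); rewrite BE mul_row_block tr_row_mx mul_row_col.
  have -> : (t *m a%:M + u *m b) *m t^T + (t *m b^T + u *m D) *m u^T = u *m D' *m u^T.
    rewrite mul_mx_scalar /t scalerA mulrN mulfV ?gt_eqF// scaleN1r addNr mul0mx add0r.
    rewrite /D' mulmxBr -scalemxAr -scalemxAl scaleNr addrC mulmxA; congr (_ *m _).
  apply; apply: contra u0 => /eqP E; apply/eqP/rowP => i.
  by move/rowP: E => /(_ (rshift 1 i)); rewrite row_mxEr !mxE.
exists (block_mx (Num.sqrt a)%:M 0 ((Num.sqrt a)^-1 *: b) S').
have s0 : Num.sqrt a != 0 by rewrite sqrtr_eq0 -ltNge.
rewrite BE tr_block_mx mulmx_block trmx0 !mulmx0 !mul0mx !addr0 tr_scalar_mx.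
rewrite -scalar_mxM -expr2 sqr_sqrtr ?ltW//.
congr block_mx.
- by rewrite linearZ /= mul_scalar_mx scalerA mulfV// scale1r.
- by rewrite mul_mx_scalar scalerA mulfV// scale1r.
- rewrite linearZ /= -scalemxAl -scalemxAr scalerA -invfM -expr2 sqr_sqrtr ?ltW//.
  by rewrite -D'E /D' addrC subrK.
Qed.

Lemma posdef_unit n (B : 'M[R]_n) :
  (forall u : 'rV_n, u != 0 -> 0 < (u *m B *m u^T) 0 0) -> B \in unitmx.
Proof.
move=> posB; rewrite -row_free_unit -kermx_eq0.
apply/eqP/row_matrixP => i; rewrite row0; apply/eqP/negPn/negP => u0.
have := posB _ u0; rewrite -row_mul mulmx_ker row0 mul0mx mxE ltxx.
by [].
Qed.

Lemma posdef_inv_factor n (B : 'M[R]_n) : B^T = B ->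
  (forall u : 'rV_n, u != 0 -> 0 < (u *m B *m u^T) 0 0) ->
  exists S : 'M[R]_n, invmx B = S *m S^T.
Proof.
move=> symB posB; have uB := posdef_unit posB.
apply: posdef_factor => [|u u0]; first by rewrite trmx_inv symB.
have := posB (u *m invmx B); rewrite mulmxKV// trmx_mul trmx_inv symB mulmxA; apply.
by apply: contra u0 => /eqP E; rewrite -(mulmxKV uB u) E mul0mx.
Qed.

(** For a block diagonal metric, an orthonormal frame of the base and the
    normalized circle direction form an orthonormal frame.  The squares of the
    components in it that involve base indices only add up to the squared norm
    of the restricted tensor, so restricting a tensor decreases its norm. *)
Section WarpedNorms.
Context (n : nat) (G : 'rV[R]_n -> 'M[R]_n) (H : 'rV[R]_(1 + n) -> 'M[R]_(1 + n))
  (S : 'M[R]_n) (x : 'rV[R]_n) (y : 'rV[R]_(1 + n)) (s : R).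
Hypotheses (GS : invmx (G x) = S *m S^T)
  (HS : invmx (H y) = block_mx (s ^+ 2)%:M 0 0 (invmx (G x))).

Let Z : 'M[R]_(1 + n) := block_mx s%:M 0 0 S.

Lemma warped_frame : invmx (H y) = Z *m Z^T.
Proof.
rewrite HS GS tr_block_mx !trmx0 mulmx_block !mulmx0 !mul0mx !addr0 add0r.
by rewrite tr_scalar_mx -scalar_mxM expr2.
Qed.

Lemma frame1_r T a : frame1 Z T (rshift 1 a) = frame1 S (fun i => T (rshift 1 i)) a.
Proof.
rewrite /frame1 sum_circle block_mxEur mxE mul0r add0r.
by apply: eq_bigr => i _; rewrite block_mxEdr.
Qed.

Lemma frame1_l T : frame1 Z T (lshift n ord0) = s * T (lshift n ord0).
Proof.
rewrite /frame1 sum_circle block_mxEul mxE eqxx mulr1n big1 ?addr0// => i _.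
by rewrite block_mxEdl mxE mul0r.
Qed.

Lemma sum_circle_ge (F : 'I_(1 + n) -> R) : (forall a, 0 <= F a) ->
  \sum_a F (rshift 1 a) <= \sum_a F a.
Proof. by move=> F0; rewrite sum_circle lerDr. Qed.

Lemma norm2_base_le T :
  norm2 G (fun i j _ => T (rshift 1 i) (rshift 1 j) y) x <= norm2 H T y.
Proof.
rewrite (norm2_frame GS) (norm2_frame warped_frame) ler_wsqrtr//.
apply: le_trans (sum_circle_ge _); last first.
  by move=> a; apply: sumr_ge0 => b _; exact: sqr_ge0.
apply: ler_sum => a _; apply: le_trans (sum_circle_ge _); last first.
  by move=> b; exact: sqr_ge0.
apply: ler_sum => b _; rewrite /frame2 frame1_r.
by under [in leRHS]eq_fun do rewrite frame1_r.
Qed.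

Lemma norm3_base_le T :
  norm3 G (fun i j k _ => T (rshift 1 i) (rshift 1 j) (rshift 1 k) y) x <=
  norm3 H T y.
Proof.
rewrite (norm3_frame GS) (norm3_frame warped_frame) ler_wsqrtr//.
apply: le_trans (sum_circle_ge _); last first.
  by move=> a; do 2 (apply: sumr_ge0 => ? _); exact: sqr_ge0.
apply: ler_sum => a _; apply: le_trans (sum_circle_ge _); last first.
  by move=> b; apply: sumr_ge0 => ? _; exact: sqr_ge0.
apply: ler_sum => b _; apply: le_trans (sum_circle_ge _); last first.
  by move=> c; exact: sqr_ge0.
apply: ler_sum => c _; rewrite /frame3 frame1_r /frame2.
under [in leRHS]eq_fun do rewrite frame1_r.
by under [in leRHS]eq_fun do under eq_fun do rewrite frame1_r.
Qed.

Lemma norm4_base_le T :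
  norm4 G (fun i j k l _ =>
    T (rshift 1 i) (rshift 1 j) (rshift 1 k) (rshift 1 l) y) x <= norm4 H T y.
Proof.
rewrite (norm4_frame GS) (norm4_frame warped_frame) ler_wsqrtr//.
apply: le_trans (sum_circle_ge _); last first.
  by move=> a; do 3 (apply: sumr_ge0 => ? _); exact: sqr_ge0.
apply: ler_sum => a _; apply: le_trans (sum_circle_ge _); last first.
  by move=> b; do 2 (apply: sumr_ge0 => ? _); exact: sqr_ge0.
apply: ler_sum => b _; apply: le_trans (sum_circle_ge _); last first.
  by move=> c; apply: sumr_ge0 => ? _; exact: sqr_ge0.
apply: ler_sum => c _; apply: le_trans (sum_circle_ge _); last first.
  by move=> d; exact: sqr_ge0.
apply: ler_sum => d _; rewrite /frame4 frame1_r /frame3.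
under [in leRHS]eq_fun do rewrite frame1_r /frame2.
under [in leRHS]eq_fun do under eq_fun do rewrite frame1_r.
by under [in leRHS]eq_fun do under eq_fun do under eq_fun do rewrite frame1_r.
Qed.

(** The factor s^-2 undoes the normalization of the two circle arguments, so
    [T] is, up to sign, the (base, circle, circle) part of [T3] in the frame. *)
Lemma norm1_circle_le (T : 'I_n -> R) T3 :
  (forall k, T3 (rshift 1 k) (lshift n ord0) (lshift n ord0) y = - s ^- 2 * T k) ->
  s != 0 ->
  norm1 G (fun k _ => T k) x <= norm3 H T3 y.
Proof.
move=> TT s0.
rewrite (norm1_frame GS) (norm3_frame warped_frame) ler_wsqrtr//.
apply: le_trans (sum_circle_ge _); last first.
  by move=> a; do 2 (apply: sumr_ge0 => ? _); exact: sqr_ge0.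
apply: ler_sum => a _.
rewrite sum_circle sum_circle -addrA.
have -> : frame1 S T a ^+ 2 = frame3 Z (fun i j k => T3 i j k y) (rshift 1 a)
    (lshift n ord0) (lshift n ord0) ^+ 2.
  rewrite /frame3 frame1_r /frame1 -[LHS]sqrrN -sumrN; congr (_ ^+ 2).
  apply: eq_bigr => i _; rewrite -!/(frame1 _ _ _) -/(frame2 _ _ _ _).
  by rewrite /frame2 !frame1_l TT; field.
rewrite lerDl addr_ge0//; first by apply: sumr_ge0 => ? _; exact: sqr_ge0.
by apply: sumr_ge0 => ? _; apply: sumr_ge0 => ? _; exact: sqr_ge0.
Qed.

End WarpedNorms.
End TensorNorms.

(** * Smooth curves, their lengths, and the distance *)

Lemma C_on_sum (R : realType) (n k : nat) (U : set 'rV[R]_n) (I : Type)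
    (s : seq I) (F : I -> 'rV[R]_n -> R) :
  open U -> (forall j, C_on k U (F j)) ->
  C_on k U (fun x => \sum_(j <- s) F j x).
Proof.
move=> oU CF; elim: s => [|j s IH].
  by apply: C_on_eq (C_on_cst k U 0) => // x; rewrite big_nil.
by apply: C_on_eq (C_on_add oU (CF j) IH) => // x; rewrite big_cons.
Qed.

Section Lines.
Context (R : realType) (n : nat).
Implicit Types (U D : set 'rV[R]_n) (f : 'rV[R]_n -> R) (z w : 'rV[R]_n).

Lemma smooth_differentiable U f x : open U -> smooth_on U f -> U x ->
  differentiable f x.
Proof. by move=> oU sf; exact: C1_differentiable (sf 1%N). Qed.

Lemma derive_partial f x w : differentiable f x ->
  'D_w f x = \sum_i w 0 i * partial i f x.
Proof.
move=> df; rewrite deriveE// {1}(row_sum_delta w) linear_sum.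
by apply: eq_bigr => i _; rewrite linearZ /= /partial deriveE.
Qed.

Definition line z w (t : 'rV[R]_1) : 'rV[R]_n := z + t 0 0 *: w.

Lemma continuous_line z w : continuous (line z w).
Proof.
move=> t.
have h1 : (fun _ : 'rV[R]_1 => z) @ t --> z by exact: cst_continuous.
have h2 : {for t, continuous (fun s : 'rV[R]_1 => s 0 0 *: w)}.
  by apply: continuousZr_tmp; exact: coord_continuous.
exact: cvgD h1 h2.
Qed.

Lemma open_line z w D : open D -> open (line z w @^-1` D).
Proof. by move=> oD; apply: open_comp => // t _; exact: continuous_line. Qed.

Lemma growth_line f z w (t : 'rV[R]_1) :
  (fun h : R => h^-1 *: (((f \o line z w) \o shift t) (h *: delta_mx 0 0) -
     (f \o line z w) t)) =
  (fun h => h^-1 *: ((f \o shift (line z w t)) (h *: w) - f (line z w t))).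
Proof.
apply/funext => h /=; congr (_ *: (f _ - _)).
by rewrite /line !mxE eqxx mulr1 scalerDl addrCA.
Qed.

(** Derivatives along the line are combinations of partial derivatives, with
    the direction as constant coefficients, so smoothness is inherited degree
    by degree. *)
Lemma smooth_on_line D f z w : open D -> smooth_on D f ->
  smooth_on (line z w @^-1` D) (f \o line z w).
Proof.
move=> oD + k; elim: k f => [|k IH] f sf.
  split=> // t Dt; apply: continuous_comp; first exact: continuous_line.
  exact: smooth_on_continuous sf Dt.
split=> [t Dt|i].
  apply: continuous_comp; first exact: continuous_line.
  exact: smooth_on_continuous sf Dt.
rewrite [i]ord1; split=> [t Dt|].
  rewrite /derivable growth_line.
  exact: diff_derivable (smooth_differentiable oD sf Dt).
have C1 : C_on k (line z w @^-1` D)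
    (fun t => \sum_j w 0 j * (partial j f \o line z w) t).
  apply: C_on_sum; first exact: open_line.
  move=> j; apply: C_on_mul; [exact: open_line|exact: C_on_cst|].
  by apply: IH; exact: smooth_on_partial.
apply: C_on_eq C1; first exact: open_line.
move=> t Dt; rewrite -(derive_partial _ (smooth_differentiable oD sf Dt)).
by rewrite /partial /derive growth_line.
Qed.

End Lines.

(** Curves are tested for smoothness on 'rV_1, while velocities use derivatives
    of functions of a real variable; the two coincide. *)
Section CurvesOneVariable.
Context (R : realType).
Implicit Types (u : R -> R) (W : set R).

Lemma growth_real u (x : 'rV[R]_1) :
  (fun h : R => h^-1 *: (((fun y : 'rV[R]_1 => u (y 0 0)) \o shift x)
     (h *: delta_mx 0 0) - u (x 0 0))) =
  (fun h => h^-1 *: ((u \o shift (x 0 0)) (h *: 1) - u (x 0 0))).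
Proof.
apply/funext => h /=; congr (_ *: (u _ - _)).
by rewrite !mxE eqxx mulr1 scaler1.
Qed.

Lemma partial_real u (x : 'rV[R]_1) :
  partial 0 (fun y : 'rV[R]_1 => u (y 0 0)) x = derive1 u (x 0 0).
Proof.
by rewrite derive1E /partial /derive growth_real.
Qed.

Lemma derivable_real u (x : 'rV[R]_1) :
  derivable (fun y : 'rV[R]_1 => u (y 0 0)) x (delta_mx 0 0) ->
  derivable u (x 0 0) 1.
Proof.
by rewrite /derivable growth_real.
Qed.

Lemma continuous_real u (t : R) :
  {for (const_mx t : 'rV[R]_1), continuous (fun y : 'rV[R]_1 => u (y 0 0))} ->
  {for t, continuous u}.
Proof.
move=> cu.
have cc : {for t, continuous (const_mx : R -> 'rV[R]_1)}.
  move=> A /= [B Bt BA]; rewrite !nbhs_simpl /=.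
  have : nbhs t (B 0 0) by have := Bt 0 0; rewrite mxE.
  apply: filterS => s Bs; apply: BA => i j; rewrite !ord1 mxE //.
have := continuous_comp cc cu.
by rewrite (_ : _ \o _ = u)//; apply/funext => s /=; rewrite mxE.
Qed.

Lemma smooth_on_real (D : set 'rV[R]_1) u t :
  D (const_mx t) -> smooth_on D (fun y : 'rV[R]_1 => u (y 0 0)) ->
  derivable u t 1 /\ {for t, continuous (derive1 u)}.
Proof.
move=> Dt su; split.
  by have := derivable_real (smooth_on_derivable (i := 0) su Dt); rewrite mxE.
apply: continuous_real.
have := smooth_on_continuous (smooth_on_partial 0 su) Dt.
rewrite (_ : partial _ _ = fun y => derive1 u (y 0 0))//.
by apply/funext => x; exact: partial_real.
Qed.

End CurvesOneVariable.

Lemma continuous_sum_at (R : realType) (T : topologicalType) (I : Type)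
    (s : seq I) (F : I -> T -> R) t :
  (forall j, {for t, continuous (F j)}) ->
  {for t, continuous (fun x => \sum_(j <- s) F j x)}.
Proof.
move=> cF; elim: s => [|j s IH].
  rewrite (_ : (fun x => _) = cst 0); first exact: cst_continuous.
  by apply/funext => x; rewrite big_nil.
rewrite (_ : (fun x => _) = fun x => F j x + \sum_(j <- s) F j x).
  exact: continuousD.
by apply/funext => x; rewrite big_cons.
Qed.

(* [coord] also names the coordinates of a vector in a basis. *)
Local Notation coord := Defs.coord.

Section Charts.
Context (R : realType) (n : nat) (M : topologicalType) (A : atlas R n M).
Hypothesis smA : smooth_atlas A.
Implicit Types (c d : chart A) (p q : M).

Lemma coord_spec c p : range_chart c p -> dom c (coord c p) /\ par c (coord c p) = p.
Proof.
move=> [x Dx xp]; rewrite /coord.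
by apply: (xgetPex 0 (P := [set x | dom c x /\ par c x = p])); exists x.
Qed.

Lemma coord_par c x : dom c x -> coord c (par c x) = x.
Proof.
move=> Dx; have [_ _ inj _ _] := smA.
have [Dy E] := coord_spec (ex_intro2 _ _ x Dx erefl).
exact: inj Dy Dx E.
Qed.

Lemma open_range c : open (range_chart c).
Proof. by have [_ od _ /(_ c)[_ +] _] := smA; apply. Qed.

Lemma coord_continuous_chart c p : range_chart c p -> {for p, continuous (coord c)}.
Proof.
move=> /coord_spec[Dp pE] B /=; rewrite nbhsE => -[B' [oB' B'p] BB'].
have [_ od _ /(_ c)[_ op] _] := smA.
rewrite !nbhs_simpl /= nbhsE; exists (par c @` (B' `&` dom c)).
  split; first by apply: op => [|x []//]; apply: openI.
  by exists (coord c p).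
by move=> _ [x [B'x Dx] <-]; apply: BB'; rewrite coord_par.
Qed.

Definition overlap c d := dom c `&` par c @^-1` range_chart d.

Lemma open_overlap c d : open (overlap c d).
Proof.
have [_ od _ /(_ c)[cp _] _] := smA.
rewrite openE => x [Dx rx]; apply: filterI.
  exact: open_nbhs_nbhs (conj (od c) Dx).
exact: (cp _ Dx) (open_nbhs_nbhs (conj (open_range d) rx)).
Qed.

Lemma overlap_coord c d p : range_chart c p -> range_chart d p -> overlap c d (coord c p).
Proof. by move=> /coord_spec[Dp pE] rd; split=> //=; rewrite pE. Qed.

Definition transition c d (x : 'rV[R]_n) : 'rV[R]_n := coord d (par c x).

Lemma differentiable_transition c d x : overlap c d x ->
  differentiable (transition c d) x.
Proof.
move=> Ox; have [_ _ _ _ sm] := smA.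
have -> : transition c d = \sum_(j < n) (fun y => coord d (par c y) 0 j *: delta_mx 0 j).
  by apply/funext => y; rewrite fct_sumE -row_sum_delta.
apply: differentiable_sum => j; apply: differentiableZl.
exact: smooth_differentiable (@open_overlap c d) (sm c d j) Ox.
Qed.

End Charts.

Section Curves.
Context (R : realType) (n : nat) (M : topologicalType) (A : atlas R n M).
Hypothesis smA : smooth_atlas A.
Implicit Types (c d : chart A) (p q : M) (gamma : R -> M) (W : set R).

Section RegularCurve.
Variables (gamma : R -> M) (W : set R).
Hypotheses (oW : open W) (sg : smooth_map (real_atlas R) A W gamma).

Lemma near_range c t : W t -> range_chart c (gamma t) ->
  \forall s \near t, W s /\ range_chart c (gamma s).
Proof.
move=> Wt rt; apply: filterI; first exact: open_nbhs_nbhs (conj oW Wt).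
exact: (sg.1 _ Wt) (open_nbhs_nbhs (conj (open_range smA c) rt)).
Qed.

Lemma curve_coord_C1 c t j : W t -> range_chart c (gamma t) ->
  derivable (curve_coord c gamma j) t 1 /\
  {for t, continuous (derive1 (curve_coord c gamma j))}.
Proof.
move=> Wt rt; apply: smooth_on_real (sg.2 tt c j).
by split=> //=; rewrite mxE.
Qed.

Lemma derivable_curve c t : W t -> range_chart c (gamma t) ->
  derivable (coord c \o gamma) t 1.
Proof.
move=> Wt rt; apply/derivable_mxP => i j; rewrite [i]ord1.
exact: (curve_coord_C1 j Wt rt).1.
Qed.

Lemma velocityE c t : W t -> range_chart c (gamma t) ->
  velocity c gamma t = 'D_1 (coord c \o gamma) t.
Proof.
move=> Wt rt; rewrite derive_mx; last exact: derivable_curve.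
by apply/rowP => j; rewrite !mxE derive1E.
Qed.

(** The chain rule for the change of charts, in the row-vector convention: the
    jacobian acts on the right. *)
Lemma velocity_transition c d t : W t ->
  range_chart c (gamma t) -> range_chart d (gamma t) ->
  velocity d gamma t =
  velocity c gamma t *m jacobian (transition c d) (coord c (gamma t)).
Proof.
move=> Wt rc rd; rewrite !velocityE//.
have dtau := differentiable_transition smA (overlap_coord rc rd).
have du : differentiable (coord c \o gamma) t.
  by apply/derivable1_diffP; exact: derivable_curve.
have -> : 'D_1 (coord d \o gamma) t =
    'D_1 (transition c d \o (coord c \o gamma)) t.
  apply: near_eq_derive; near=> s; rewrite /transition /=.
  suff /coord_spec[_ ->//] : range_chart c (gamma s).
  by near: s; apply: filterS (near_range Wt rc) => s [].
rewrite -deriveEjacobian// [LHS]deriveE; last exact: differentiable_comp.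
by rewrite diff_comp// deriveE// [in RHS]deriveE.
Unshelve. all: by end_near.
Qed.

Variable g : metric A.
Hypothesis rg : riemannian_metric g.

(** [speed] uses the chart chosen at each point, which may jump along the
    curve; a fixed chart gives a continuous expression. *)
Definition chart_speed c t : R :=
  Num.sqrt ((velocity c gamma t *m g c (coord c (gamma t))
             *m (velocity c gamma t)^T) 0 0).

Lemma chart_speed_indep c d t : W t ->
  range_chart c (gamma t) -> range_chart d (gamma t) ->
  chart_speed c t = chart_speed d t.
Proof.
move=> Wt rc rd; have [_ _ _ tr] := rg.
have [Dc pc] := coord_spec rc.
rewrite /chart_speed; have := tr c d _ Dc; rewrite pc => /(_ rd) ->.
rewrite (velocity_transition Wt rc rd) pc trmx_mul !mulmxA.
by [].
Qed.

Lemma chart_speed_continuous c t : W t -> range_chart c (gamma t) ->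
  {for t, continuous (chart_speed c)}.
Proof.
move=> Wt rc; have [sm _ _ _] := rg; have [Dc pc] := coord_spec rc.
have -> : chart_speed c = Num.sqrt \o (fun s =>
    \sum_j (\sum_i derive1 (curve_coord c gamma i) s * g c (coord c (gamma s)) i j) *
       derive1 (curve_coord c gamma j) s).
  apply/funext => s; rewrite /chart_speed /=; congr Num.sqrt; rewrite mxE.
  apply: eq_bigr => j _; rewrite !mxE; congr (_ * _).
  by apply: eq_bigr => i _; rewrite mxE.
apply: continuous_comp; last exact: sqrt_continuous.
have ccont : {for t, continuous (coord c \o gamma)}.
  apply: continuous_comp; first exact: sg.1.
  exact: coord_continuous_chart smA _ _ rc.
apply: continuous_sum_at => j; apply: continuousM; last exact: (curve_coord_C1 j Wt rc).2.
apply: continuous_sum_at => i; apply: continuousM; first exact: (curve_coord_C1 i Wt rc).2.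
have gc : {for coord c (gamma t), continuous (fun x => g c x i j)}.
  exact: smooth_on_continuous (sm c i j) Dc.
exact: (continuous_comp ccont gc).
Qed.

(** Near a given time the speed may be computed in one fixed chart, by
    [chart_speed_indep]. *)
Lemma speed_continuous t : W t -> {for t, continuous (speed g gamma)}.
Proof.
move=> Wt; have [cov _ _ _ _] := smA.
set c := chart_at A (gamma t); have rc : range_chart c (gamma t) by exact: cov.
apply: near_eq_continuous (chart_speed_continuous Wt rc).
apply: filterS (near_range Wt rc) => s [Ws rs].
by rewrite (chart_speed_indep Ws rs (cov (gamma s))).
Qed.

(** Lengths are compared through integrals, whose real value is 0 by convention
    on non-integrable functions: monotonicity needs this fact. *)
Lemma speed_integrable : `[0, 1] `<=` W ->
  lebesgue_measure.-integrable `[0, 1] (EFin \o speed g gamma).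
Proof.
move=> sW; apply: continuous_compact_integrable; first exact: segment_compact.
apply: continuous_in_subspaceT => t; rewrite inE => t01.
exact/speed_continuous/sW.
Qed.

End RegularCurve.

Lemma curve_length_ge0 (g : metric A) gamma : 0 <= curve_length g gamma.
Proof. by apply: Rintegral_ge0 => t _; exact: sqrtr_ge0. Qed.

Lemma piecewise_cat p q r s s' : piecewise_path A p s q ->
  piecewise_path A q s' r -> piecewise_path A p (s ++ s') r.
Proof.
elim: s p => [|gamma s IH] p /=; first by move=> ->.
by move=> [sm g0 pp] pq; split=> //; exact: IH.
Qed.

Lemma segment_path c (y y' : 'rV[R]_n) :
  (forall t : R, 0 <= t <= 1 -> dom c (y + t *: (y' - y))) ->
  exists gamma, piecewise_path A (par c y) [:: gamma] (par c y').
Proof.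
move=> seg; have [_ od _ /(_ c)[cp _] trs] := smA.
pose w := y' - y; pose gamma (t : R) := par c (y + t *: w).
pose W := [set t : R | dom c (y + t *: w)].
have cl : continuous (fun t : R => y + t *: w).
  move=> t; have h1 : (fun=> y) @ t --> y by exact: cvg_cst.
  have h2 : (fun s : R => s *: w) @ t --> t *: w by apply: cvgZr_tmp; exact: cvg_id.
  exact: cvgD h1 h2.
have oW : open W by apply: open_comp => // t _; exact: cl.
exists gamma; split; last first.
- by rewrite /gamma scale1r subrKC.
- by rewrite /gamma scale0r addr0.
exists W; split=> //.
split=> [t Wt|[] d j].
  by apply: continuous_comp; [exact: cl|exact: cp].
have := smooth_on_line y w (@open_overlap _ _ _ _ smA c d) (trs c d j).
apply: smooth_on_sub => t [_ [Wt rt]]; by split.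
Qed.

End Curves.

Section Distance.
Context (R : realType) (n : nat) (M : topologicalType) (A : atlas R n M).
Implicit Types (c d : chart A) (p q : M) (g : metric A).

(** The points that can be reached from [p] form an open and closed set, since
    a ball in a chart is convex.  Without such paths [rdist] would be the
    infimum of the empty set, that is 0. *)
Lemma piecewise_path_exists p q : smooth_manifold A ->
  exists s, piecewise_path A p s q.
Proof.
move=> [_ _ conn smA]; have [cov od _ cpar _] := smA.
have loc r : exists B : set M, [/\ open B, B r &
    forall r1 r2, B r1 -> B r2 -> exists s, piecewise_path A r1 s r2].
  set c := chart_at A r; have [Dx xr] := coord_spec (cov r : range_chart c r).
  have /nbhs_ballP[e /= e0 eD] := open_nbhs_nbhs (conj (od c) Dx).
  exists (par c @` ball (coord c r) e); split.
  - by apply: (cpar c).2 => //; exact: ball_open.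
  - by exists (coord c r) => //; exact: ballxx.
  move=> _ _ [y By <-] [y' By' <-].
  have [|gamma pg] := @segment_path _ _ _ _ smA c y y'; last by exists [:: gamma].
  move=> t /andP[t0 t1]; apply: eD.
  move: By By'; rewrite -!ball_normE /= => By By'.
  have -> : coord c r - (y + t *: (y' - y)) =
      (1 - t) *: (coord c r - y) + t *: (coord c r - y').
    by apply/rowP => i; rewrite !mxE; ring.
  apply: le_lt_trans (ler_normD _ _) _; rewrite !normrZ.
  rewrite ger0_norm ?subr_ge0// ger0_norm//.
  have : (1 - t) * `|coord c r - y| + t * `|coord c r - y'| < (1 - t) * e + t * e.
    have [->|tN0] := eqVneq t 0; first by rewrite subr0 !mul0r !addr0 !mul1r.
    apply: ler_ltD; first by rewrite ler_wpM2l ?subr_ge0// ltW.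
    by rewrite ltr_pM2l// lt_neqAle eq_sym tN0.
  by rewrite -mulrDl subrK mul1r.
pose S := [set r | exists s, piecewise_path A p s r].
suff SE : S = setT by have : S q by rewrite SE.
have extend r r' (B : set M) : (forall r1 r2, B r1 -> B r2 ->
    exists s, piecewise_path A r1 s r2) -> B r -> B r' -> S r -> S r'.
  move=> HB Br Br' [s pr]; have [s' rr'] := HB _ _ Br Br'.
  by exists (s ++ s'); exact: piecewise_cat pr rr'.
apply: conn.
- by exists p; exists [::].
- exists S; last by rewrite setTI.
  rewrite openE => r Sr; have [B [oB Br HB]] := loc r.
  rewrite /interior nbhsE; exists B => // r' Br'.
  exact: extend HB Br Br' Sr.
- exists S; last by rewrite setTI.
  rewrite -openC openE => r Sr; have [B [oB Br HB]] := loc r.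
  rewrite /interior nbhsE; exists B => // r' Br' Sr'; apply: Sr.
  exact: extend HB Br' Br Sr'.
Qed.

Lemma path_length_ge0 g (s : seq (R -> M)) :
  0 <= \sum_(gamma <- s) curve_length g gamma.
Proof. by apply: sumr_ge0 => gamma _; exact: curve_length_ge0. Qed.

Lemma rdist_le g p q s : piecewise_path A p s q ->
  rdist g p q <= \sum_(gamma <- s) curve_length g gamma.
Proof.
move=> pq; apply: ge_inf; last by exists s.
by exists 0 => _ [s' _ ->]; exact: path_length_ge0.
Qed.

Lemma le_rdist g p q l : smooth_manifold A ->
  (forall s, piecewise_path A p s q ->
    l <= \sum_(gamma <- s) curve_length g gamma) -> l <= rdist g p q.
Proof.
move=> smM H; apply: lb_le_inf.
  have [s pq] := piecewise_path_exists p q smM.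
  by exists (\sum_(gamma <- s) curve_length g gamma), s.
by move=> _ [s /H + ->].
Qed.

Lemma rdist_triangle g p q r : smooth_manifold A ->
  rdist g p r <= rdist g p q + rdist g q r.
Proof.
move=> smM; rewrite -lerBlDr; apply: le_rdist => // s pq.
rewrite lerBlDl -lerBlDr; apply: le_rdist => // s' qr.
rewrite lerBlDr addrC -big_cat; apply: rdist_le; exact: piecewise_cat pq qr.
Qed.

End Distance.

(** * Projecting paths from the product to the base *)

Section Projection.
Context (R : realType) (m n : nat) (N M : topologicalType)
  (B : atlas R m N) (A : atlas R n M).
Hypotheses (smBA : smooth_atlas (prod_atlas B A)) (smA : smooth_atlas A).
Implicit Types (p : (N * M)%type) (c : chart B) (d : chart A).

Local Notation P := (prod_atlas B A).

Lemma range_prod c d p : range_chart (A := P) (c, d) p <->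
  range_chart c p.1 /\ range_chart d p.2.
Proof.
split=> [[x [/= D1 D2] <-]|[[x Dx xp] [y Dy yp]]] /=.
  by split; [exists (lsubmx x)|exists (rsubmx x)].
exists (row_mx x y); rewrite /= ?row_mxKl ?row_mxKr//.
by rewrite xp yp -surjective_pairing.
Qed.

Lemma rsubmx_coord (cd : chart P) p : range_chart cd p ->
  rsubmx (coord cd p) = coord cd.2 p.2.
Proof.
by move=> /coord_spec[[/= _ D2] E]; rewrite -[in RHS]E /= (coord_par smA D2).
Qed.

Variables (gamma : R -> (N * M)%type) (W : set R).
Hypotheses (oW : open W) (sg : smooth_map (real_atlas R) P W gamma).

Lemma continuous_snd_curve t : W t -> {for t, continuous (snd \o gamma)}.
Proof.
move=> Wt; apply: (continuous_comp (sg.1 _ Wt)); exact: cvg_snd.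
Qed.

(** A chart of the base has to be completed to a chart of the product, and one
    circle chart does not serve for all times; smoothness is local, so a
    different one may be taken at each time. *)
Lemma smooth_snd_curve : smooth_map (real_atlas R) A W (snd \o gamma).
Proof.
split=> [t|[] d j]; first exact: continuous_snd_curve.
move=> k; apply: C_on_local => x [_ [Wx rx]].
pose c := chart_at B (gamma (x 0 0)).1.
have cov p : range_chart (chart_at P p) p by have [+ _ _ _ _] := smBA; apply.
have rc : range_chart (A := P) (c, d) (gamma (x 0 0)).
  by apply/range_prod; split=> //; case: ((range_prod _ _ _).1 (cov (gamma (x 0 0)))).
pose D := [set y : 'rV[R]_1 | W (y 0 0) /\ range_chart (A := P) (c, d) (gamma (y 0 0))].
exists D, (fun y => coord ((c, d) : chart P) (gamma (y 0 0)) 0 (rshift m j)); split=> //.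
- rewrite openE => y [Wy ry].
  have := near_range smBA oW sg Wy ry.
  exact: (@coord_continuous R 1 1 0 0 y).
- apply: C_on_sub (sg.2 tt ((c, d) : chart P) (rshift m j) k).
  by move=> y [].
- move=> y [Wy ry]; rewrite /= -(rsubmx_coord ry) mxE //.
Qed.

Lemma velocity_snd (cd : chart P) t : W t -> range_chart cd (gamma t) ->
  velocity cd.2 (snd \o gamma) t = rsubmx (velocity cd gamma t).
Proof.
move=> Wt rt; apply/rowP => j; rewrite !mxE !derive1E.
apply: near_eq_derive; near=> s.
have rs : range_chart cd (gamma s).
  by near: s; apply: filterS (near_range smBA oW sg Wt rt) => s [].
by rewrite /curve_coord /= -(rsubmx_coord rs) mxE.
Unshelve. all: by end_near.
Qed.

End Projection.

Section StaticDistance.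
Context (R : realType) (n : nat) (M : topologicalType) (A : atlas R n M)
  (g : metric A) (V : M -> R).
Local Notation P := (prod_atlas (circle_atlas R) A).
Local Notation h := (static_metric g V).
Hypotheses (smP : smooth_manifold P) (rh : riemannian_metric h)
  (smM : smooth_manifold A) (rg : riemannian_metric g).

Let smPa : smooth_atlas P. Proof. by case: smP. Qed.
Let smA : smooth_atlas A. Proof. by case: smM. Qed.

(** The squared speed upstairs is that of the projection plus V^2 times the
    square of the angular velocity. *)
Lemma speed_snd_le (gamma : R -> (circle R * M)%type) (W : set R) t : open W ->
  smooth_map (real_atlas R) P W gamma -> W t ->
  speed g (snd \o gamma) t <= speed h gamma t.
Proof.
move=> oW sg Wt.
have [cov _ _ _ _] := smPa.
have rt := cov (gamma t).
rewrite /speed ler_wsqrtr//.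
rewrite -[chart_at A ((snd \o gamma) t)]/((chart_at P (gamma t)).2).
rewrite (velocity_snd smPa smA oW sg Wt rt) -(rsubmx_coord smA rt).
set c := chart_at P (gamma t); set w := velocity c gamma t.
rewrite /static_metric -[w in leRHS]hsubmxK tr_row_mx mul_row_block mul_row_col.
rewrite !mulmx0 add0r addr0 [leRHS]mxE lerDr mul_mx_scalar -scalemxAl mxE.
rewrite mulr_ge0 ?sqr_ge0// mxE sumr_ge0// => i _.
by rewrite [X in _ * X]mxE -expr2 sqr_ge0.
Qed.

Lemma curve_length_snd_le (gamma : R -> (circle R * M)%type) : smooth_path P gamma ->
  curve_length g (snd \o gamma) <= curve_length h gamma.
Proof.
move=> [W [oW sW sg]]; apply: le_Rintegral => //.
- exact: (speed_integrable smA oW (smooth_snd_curve smPa smA oW sg) rg sW).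
- exact: (speed_integrable smPa oW sg rh sW).
- by move=> t t01; apply: speed_snd_le oW sg _; exact: sW.
Qed.

(** Projecting the smooth pieces of a path does not increase their lengths.
    This turns decay in the distance of the product into decay in the distance
    of the base. *)
Lemma rdist_snd_le (p q : (circle R * M)%type) : rdist g p.2 q.2 <= rdist h p q.
Proof.
apply: le_rdist => // s pq.
suff [s' pq' le] : exists2 s', piecewise_path A p.2 s' q.2 &
    \sum_(gamma <- s') curve_length g gamma <= \sum_(gamma <- s) curve_length h gamma.
  exact: le_trans (rdist_le g pq') le.
elim: s p pq => [|gamma s IH] p /=; first by move=> ->; exists [::]; rewrite ?big_nil.
move=> [[W [oW sW sg]] g0 /IH[s' pq' le]].
exists (snd \o gamma :: s'); last first.
  by rewrite !big_cons lerD//; apply: curve_length_snd_le; exists W.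
split=> //; last by rewrite -g0.
have sm := smooth_snd_curve smPa smA oW sg; by exists W.
Qed.

End StaticDistance.

(** * Comparison of the tensors of the base and of the warped product *)

Section NormExt.
Context (R : realType) (n : nat) (G : 'rV[R]_n -> 'M[R]_n) (x : 'rV[R]_n).

Lemma eq_norm1 T T' : (forall i, T i x = T' i x) -> norm1 G T x = norm1 G T' x.
Proof. by move=> E; congr Num.sqrt; do 2 (apply: eq_bigr => ? _); rewrite !E. Qed.

Lemma eq_norm2 T T' : (forall i j, T i j x = T' i j x) ->
  norm2 G T x = norm2 G T' x.
Proof. by move=> E; congr Num.sqrt; do 4 (apply: eq_bigr => ? _); rewrite !E. Qed.

Lemma eq_norm3 T T' : (forall i j k, T i j k x = T' i j k x) ->
  norm3 G T x = norm3 G T' x.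
Proof. by move=> E; congr Num.sqrt; do 6 (apply: eq_bigr => ? _); rewrite !E. Qed.

Lemma eq_norm4 T T' : (forall i j k l, T i j k l x = T' i j k l x) ->
  norm4 G T x = norm4 G T' x.
Proof. by move=> E; congr Num.sqrt; do 8 (apply: eq_bigr => ? _); rewrite !E. Qed.

End NormExt.

Section WarpedEstimates.
Context (R : realType) (n : nat) (G : 'rV[R]_n -> 'M[R]_n) (v : 'rV[R]_n -> R)
  (U : set 'rV[R]_n) (H : 'rV[R]_(1 + n) -> 'M[R]_(1 + n)).
Hypotheses (oU : open U)
  (sG : forall i j, smooth_on U (fun x => G x i j))
  (symG : forall x, U x -> (G x)^T = G x)
  (posG : forall x, U x -> forall u : 'rV[R]_n, u != 0 -> 0 < (u *m G x *m u^T) 0 0)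
  (sv : smooth_on U v) (v0 : forall x, U x -> v x != 0)
  (HE : forall y, H y = block_mx (v (rsubmx y) ^+ 2)%:M 0 0 (G (rsubmx y))).
Variable y : 'rV[R]_(1 + n).
Hypothesis Uy : U (rsubmx y).

Let uG x : U x -> G x \in unitmx.
Proof. by move=> Ux; exact: posdef_unit (posG Ux). Qed.

Let HS : invmx (H y) = block_mx ((v (rsubmx y))^-1 ^+ 2)%:M 0 0 (invmx (G (rsubmx y))).
Proof. by rewrite (invmx_warped uG v0 HE Uy) exprVn. Qed.

Let curv := fun i j k l z => riemann H i j k l z - hyperbolic H i j k l z.

Lemma norm4_warped_le :
  norm4 G (fun i j k l z => riemann G i j k l z - hyperbolic G i j k l z) (rsubmx y)
  <= norm4 H curv y.
Proof.
have [S GS] := posdef_inv_factor (symG Uy) (posG Uy).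
apply: le_trans (norm4_base_le GS HS curv).
rewrite le_eqVlt; apply/orP; left; apply/eqP; apply: eq_norm4 => i j k l.
rewrite /curv (riemann_warped oU uG v0 HE)//.
by rewrite /hyperbolic HE !block_mxEdr.
Qed.

Lemma norm2_warped_le :
  norm2 G (fun i j z => ricci G i j z + n%:R * G z i j - (v z)^-1 * hessian G v i j z)
    (rsubmx y)
  <= Num.sqrt (1 + n)%:R * norm4 H curv y.
Proof.
have [S GS] := posdef_inv_factor (symG Uy) (posG Uy).
apply: le_trans (norm2_trace_le (warped_frame GS HS) curv).
apply: le_trans (norm2_base_le GS HS _).
rewrite le_eqVlt; apply/orP; left; apply/eqP; apply: eq_norm2 => j l.
by rewrite -(trace_curvature_warped oU symG uG sv v0 HE).
Qed.

Lemma norm3_warped_le :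
  norm3 G (cov_tensor2 G (fun i j z => ricci G i j z - (v z)^-1 * hessian G v i j z))
    (rsubmx y)
  <= norm3 H (cov_tensor2 H (ricci H)) y.
Proof.
have [S GS] := posdef_inv_factor (symG Uy) (posG Uy).
apply: le_trans (norm3_base_le GS HS _).
rewrite le_eqVlt; apply/orP; left; apply/eqP; apply: eq_norm3 => k i j.
by rewrite -(cov_ricci_warped oU uG sv v0 HE).
Qed.

Lemma norm1_warped_le :
  norm1 G (fun i => partial i (fun z => (v z)^-1 * laplacian G v z)) (rsubmx y)
  <= norm3 H (cov_tensor2 H (ricci H)) y.
Proof.
have [S GS] := posdef_inv_factor (symG Uy) (posG Uy).
apply: le_trans (norm1_circle_le GS HS _ _); last 2 first.
- move=> k; rewrite (cov_ricci_warped_circle oU sG symG uG sv v0 HE)//.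
  by rewrite exprVn invrK.
- by rewrite invr_neq0// v0.
by rewrite le_eqVlt; apply/orP; left; apply/eqP; apply: eq_norm1.
Qed.

End WarpedEstimates.

(** A point of the base is lifted to angle 0, in the angle chart centred
    there. *)
Lemma static_dom (R : realType) (n : nat) (M : topologicalType)
    (A : atlas R n M) (c : chart A) x : dom c x ->
  dom ((0, c) : chart (prod_atlas (circle_atlas R) A)) (row_mx 0 x).
Proof.
move=> Dx /=; rewrite row_mxKl row_mxKr; split=> //.
by rewrite mxE sub0r add0r oppr_lt0 pi_gt0.
Qed.

(** A change of base point at distance [s] costs a constant factor. *)
Lemma expR_decay_le (R : realType) (b C r s t : R) : 0 <= b -> 0 <= C ->
  r <= s + t -> C * expR (- (b * t)) <= C * expR (b * s) * expR (- (b * r)).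
Proof.
move=> b0 C0 rst; rewrite -mulrA -expRD ler_wpM2l// ler_expR.
by have := ler_wpM2l b0 rst; lra.
Qed.

Theorem proposition1p8 (R : realType) (n : nat) (M : topologicalType)
    (A : atlas R n M) (g : metric A) (V : M -> R) (a : R) :
  (3 <= n)%N -> 2 <= a -> asymptotically_static g V a ->
  asymptotically_hyperbolic g 2 /\
  forall o : M, exists C : R, 0 < C /\
    forall (c : chart A) (x : 'rV[R]_n), dom c x ->
      let r := rdist g o (par c x) in
      let v := V \o par c in
      [/\ norm2 (g c) (fun i j y =>
              ricci (g c) i j y + n%:R * g c y i j
              - (v y)^-1 * hessian (g c) v i j y) x
            <= C * expR (- (2 * r)),
          norm1 (g c) (fun i =>
              partial i (fun y => (v y)^-1 * laplacian (g c) v y)) x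
            <= C * expR (- (a * r))
        & norm3 (g c) (cov_tensor2 (g c) (fun i j y =>
              ricci (g c) i j y - (v y)^-1 * hessian (g c) v i j y)) x
            <= C * expR (- (a * r))].
Proof.
move=> _ a2 [[cg _] [sV Vpos]].
case=> hc [p1 [C1 [C1pos AHh]]] [p2 [C2 [C2pos Hric]]].
have [smM rg _ _] := cg; have [smP rh _ _] := hc.
have [sg symg posg _] := rg.
have [_ _ _ [_ od _ _ _]] := smM.
have sv (c : chart A) : smooth_on (dom c) (V \o par c).
  by apply: smooth_on_sub (sV c) => x Dx; split.
have v0 (c : chart A) x : dom c x -> (V \o par c) x != 0 by move=> _; rewrite gt_eqF ?Vpos.
have a0 : 0 <= a by apply: le_trans a2.
pose h := static_metric g V.
pose cd (c : chart A) : chart (prod_atlas (circle_atlas R) A) := (0, c).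
pose y x : 'rV[R]_(1 + n) := row_mx 0 x.
have yx x : rsubmx (y x) = x by rewrite row_mxKr.
have HE (c : chart A) z : h (cd c) z =
  block_mx ((V \o par c) (rsubmx z) ^+ 2)%:M 0 0 (g c (rsubmx z)) by [].
have Uy (c : chart A) x : dom c x -> dom c (rsubmx (y x)) by rewrite yx.
have rle o p (c : chart A) x : rdist g o (par c x) <=
    rdist g o p.2 + rdist h p (par (cd c) (y x)).
  apply: le_trans (rdist_triangle g o p.2 _ smM) _; rewrite lerD2l.
  by have := rdist_snd_le smP rh smM rg p (par (cd c) (y x)); rewrite /= yx.
split.
  split=> //; exists p1.2, C1; split=> // c x Dx.
  have := norm4_warped_le (od c) (symg c) (posg c) (@v0 c) (HE c) (Uy _ _ Dx).
  rewrite yx => /le_trans; apply; apply: le_trans (AHh _ _ (static_dom Dx)) _.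
  rewrite ler_pM2l// ler_expR lerN2 ler_pM2l//.
  by have := rdist_snd_le smP rh smM rg p1 (par (cd c) (y x)); rewrite /= yx.
move=> o.
(* [K1] absorbs the trace constant and the change from [p1] to [o]; [K2] the
   change from [p2] to [o] *)
pose K1 := Num.sqrt (1 + n)%:R * C1 * expR (2 * rdist g o p1.2).
pose K2 := C2 * expR (a * rdist g o p2.2).
have K1pos : 0 < K1 by rewrite !mulr_gt0 ?expR_gt0// sqrtr_gt0 ltr0n.
have K2pos : 0 < K2 by rewrite mulr_gt0 ?expR_gt0.
exists (K1 + K2); split; first exact: addr_gt0.
move=> c x Dx /=.
have W2 : K1 * expR (- (2 * rdist g o (par c x))) <=
    (K1 + K2) * expR (- (2 * rdist g o (par c x))).
  by rewrite ler_wpM2r ?expR_ge0// lerDl ltW.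
have Wa : norm3 (h (cd c)) (cov_tensor2 (h (cd c)) (ricci (h (cd c)))) (y x) <=
    (K1 + K2) * expR (- (a * rdist g o (par c x))).
  apply: le_trans (Hric _ _ (static_dom Dx)) _.
  apply: le_trans (expR_decay_le a0 (ltW C2pos) (rle o p2 c x)) _.
  by rewrite ler_wpM2r ?expR_ge0// lerDr ltW.
split.
- have := norm2_warped_le (od c) (symg c) (posg c) (sv c) (@v0 c) (HE c) (Uy _ _ Dx).
  rewrite yx => /le_trans; apply; apply: le_trans W2.
  rewrite /K1 -!mulrA ler_wpM2l ?sqrtr_ge0// mulrA.
  apply: le_trans (AHh _ _ (static_dom Dx)) _.
  exact: expR_decay_le (ler0n _ 2) (ltW C1pos) (rle o p1 c x).
- have := norm1_warped_le (od c) (sg c) (symg c) (posg c) (sv c) (@v0 c) (HE c) (Uy _ _ Dx).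
  by rewrite yx => /le_trans; apply.
- have := norm3_warped_le (od c) (symg c) (posg c) (sv c) (@v0 c) (HE c) (Uy _ _ Dx).
  by rewrite yx => /le_trans; apply.
Qed.
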